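(* Let $\lambda\in\mathbb{R}$. Let $(X,d_X)$ be a (non-extended) metric space, and let $E:X\to(-\infty,\infty]$ be bounded from below with nonempty domain $D(E)=\{E<\infty\}$. Let $Y\subset X$ be such that $(Y,d_Y)$, with $d_Y$ the induced length metric, is a genuine (non-extended) metric space. Suppose that for each $y\in Y\cap D(E)$ there exists an $\mathrm{EVI}_\lambda$-flow $(\gamma^y_t)_{t>0}$ of $E$ in $(X,d_X)$ which starts from $y$, such that $\gamma^y_t\in Y$ for each $t>0$. Then, for all $y\in Y$, $$|\partial E|(y)=\limsup_{y'\to y,\ y'\in Y}\frac{(E(y)-E(y'))_+}{d_Y(y,y')}=\limsup_{y'\to y,\ y'\in Y}\frac{(E(y)-E(y'))_+}{d_X(y,y')}.$$
   Context: Slope: $|\partial E|:X\to[0,\infty]$ is $|\partial E|(x)=\infty$ if $E(x)=\infty$, $|\partial E|(x)=0$ if $x$ is isolated in $X$ (and $E(x)<\infty$), and otherwise $|\partial E|(x)=\limsup_{x'\to x}\frac{(E(x)-E(x'))_+}{d_X(x,x')}$. The second and third expressions in the claim are the slopes of $E|_Y$ in the metric spaces $(Y,d_Y)$ and $(Y,d_X|_{Y\times Y})$ respectively: convergence $y'\to y$ is in the respective metric, and the same conventions are used (value $\infty$ if $E(y)=\infty$; otherwise value $0$ if $y$ is isolated in the respective space). Absolutely continuous curves: for a bounded interval $I$ and $p\in[1,\infty]$, $AC^p(I;(X,d_X))$ is the set of maps $\gamma:I\to X$ for which there is $m\in L^p(I)$ with $d_X(\gamma_s,\gamma_t)\le\int_s^tm(u)\,du$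 for all $s<t$ in $I$; $AC:=AC^1$. The metric derivative is $|\dot\gamma|_t=\limsup_{s\to t}d_X(\gamma_s,\gamma_t)/|s-t|$. $AC^2_{\rm loc}((0,\infty);(X,d_X))$ consists of maps $\gamma:(0,\infty)\to X$ whose restriction to each bounded interval $I\subset(0,\infty)$ is in $AC^2(I;(X,d_X))$. $\mathrm{EVI}_\lambda$-flow: $\gamma\in AC^2_{\rm loc}((0,\infty);(X,d_X))$ is an $\mathrm{EVI}_\lambda$-flow of $E$ in $(X,d_X)$ if $t\mapsto E(\gamma_t)$ is lower semicontinuous and finite-valued, and for all $x\in D(E)$ and all $t>0$, $$\frac12\frac{d^+}{dt}d_X^2(\gamma_t,x)+\frac\lambda2d_X^2(\gamma_t,x)\le E(x)-E(\gamma_t),$$ where $d^+/dt$ is the upper right derivative. It starts from $x\in D(E)$ if $d_X(\gamma_t,x)\to0$ as $t\downarrow0$ and $\liminf_{t\downarrow0}E(\gamma_t)\ge E(x)$. Induced length metric on $Y\subset X$: $d_Y(y,y')=\inf\int_0^1|\dot\gamma|_t\,dt$ over $\gamma\in AC([0,1];(X,d_X))$ with $\gamma_t\in Y$ for all $t$, $\gamma_0=y$, $\gamma_1=y'$ ($\inf\emptyset=+\infty$). *)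

(* Defs.v *)
From HB Require Import structures.
From mathcomp Require Import all_boot all_order all_algebra.
From mathcomp Require Import all_classical all_reals all_analysis.

Set Implicit Arguments.
Unset Strict Implicit.
Unset Printing Implicit Defensive.

Import Order.TTheory GRing.Theory Num.Theory.
Import numFieldNormedType.Exports.

Local Open Scope classical_set_scope.
Local Open Scope ring_scope.
Local Open Scope ereal_scope.

Section distances.
Context {R : realType} {X : metricType R}.
Implicit Types (A : set X) (d : X -> X -> \bar R) (E : X -> \bar R).

(* Several distances are put on subsets of X, and the length distance may be
   infinite a priori; distances are therefore functions X -> X -> \bar R,
   considered on a carrier A, and do not refer to the topology of X. *)
Definition emdist (x y : X) : \bar R := (mdist x y)%:E.

Definition metric_on A d :=
  [/\ forall x y, A x -> A y -> 0 <= d x y < +oo,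
      forall x y, A x -> A y -> (d x y = 0 <-> x = y),
      forall x y, A x -> A y -> d x y = d y x &
      forall x y z, A x -> A y -> A z -> d x z <= d x y + d y z].

(* Punctured neighborhoods of x in the metric space (A, d). *)
Definition punctured_nbhs A d (x : X) : set_system X :=
  [set V | exists2 e : R, (0 < e)%R &
    forall x', A x' -> x' <> x -> d x x' < e%:E -> V x'].

Definition isolated_in A d (x : X) :=
  exists2 e : R, (0 < e)%R & forall x', A x' -> d x x' < e%:E -> x' = x.

Definition eff_domain E := [set x | E x < +oo].

(* The slope at x of the restriction of E to A in the metric space (A, d). *)
Definition slope A d E (x : X) : \bar R :=
  if E x == +oo then +oo
  else if `[< isolated_in A d x >] then 0
  else limf_esup (fun x' => maxe (E x - E x') 0 / d x x')
                 (punctured_nbhs A d x).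

End distances.

Section curves.
Context {R : realType} {X : metricType R}.
Implicit Types (I : set R) (gamma : R -> X) (E : X -> \bar R).

(* Curves parametrized by I are total functions whose values outside I are
   irrelevant; the class AC_curve p I is meant for a bounded interval I and
   1 <= p <= +oo. m \_ I is the extension of m by 0 outside I. *)
Definition AC_curve (p : \bar R) I gamma :=
  exists2 m : R -> R, (m \_ I) \in Lfun (@lebesgue_measure R) p &
    forall s t, I s -> I t -> (s < t)%R ->
      (mdist (gamma s) (gamma t)
        <= \int[@lebesgue_measure R]_(u in `[s, t]) m u)%R.

(* AC^2 on every bounded interval in (0, +oo), also when 0 is an endpoint. *)
Definition AC2loc gamma :=
  forall I, is_interval I -> bounded_set I -> I `<=` `]0%R, +oo[ ->
    AC_curve 2%:E I gamma.

Definition metric_derivative I gamma (t : R) : \bar R :=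
  limf_esup (fun s : R => (mdist (gamma s) (gamma t) / `|s - t|)%:E)
            (within I t^').

Definition length_dist (Y : set X) (y y' : X) : \bar R :=
  ereal_inf [set \int[@lebesgue_measure R]_(t in `[0%R, 1%R])
                    metric_derivative `[0%R, 1%R] gamma t
            | gamma in [set gamma | [/\ AC_curve 1 `[0%R, 1%R] gamma,
                forall t : R, (0 <= t <= 1)%R -> Y (gamma t),
                gamma 0%R = y & gamma 1%R = y']]].

Definition upper_right_derivative (f : R -> R) (t : R) : \bar R :=
  limf_esup (fun h : R => ((f (t + h) - f t) / h)%:E) (0%R : R)^'+.

Definition EVI_flow (lambda : R) E gamma :=
  [/\ AC2loc gamma,
      lower_semicontinuous
        ((fun t => E (gamma t)) : subspace `]0%R, +oo[ -> \bar R),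
      forall t : R, (0 < t)%R -> E (gamma t) \is a fin_num &
      forall (x : X) (t : R), eff_domain E x -> (0 < t)%R ->
        (2^-1)%:E *
          upper_right_derivative (fun s => (mdist (gamma s) x ^+ 2)%R) t
        + (lambda / 2 * mdist (gamma t) x ^+ 2)%:E
        <= E x - E (gamma t)].

Definition starts_from E gamma (x : X) :=
  (mdist (gamma t) x @[t --> (0%R : R)^'+] --> (0%R : R)) /\
  E x <= limf_einf (fun t : R => E (gamma t)) (0%R : R)^'+.

End curves.

(* Main.v *)
(* Since d_X <= d_Y on Y, the slope decreases when (X, d_X) is replaced by
   (Y, d_X) and then by (Y, d_Y), and only |dE|(y) <= K has to be proved when
   E(y) - E(y') <= K d_Y(y, y') for y' close to y.

   Let g be the flow from y, k := max(-lambda, 0) and phi := E o g. EVI and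
   lower semicontinuity make phi nonincreasing and g contractive,
     d(g_t, g_(t+h)) <= e^(k (t-s)) d(g_s, g_(s+h))  for s <= t,
   and testing EVI at x = g_t gives
     (b - a) d(g_b, g_(b+h))^2 / h^2 <= (1 + o(1)) (phi(a) - phi(b)).
   Hence g is Lipschitz on short intervals, with a constant controlled by the
   energy lost just before. Summing over a uniform partition of vanishing mesh,
   with the arithmetic-geometric mean inequality on each piece, yields
     d_Y(y, g_t) <= (K t + (E(y) - phi(t)) / K) / 2,
   so that E(y) - phi(t) <= K d_Y(y, g_t) forces d_Y(y, g_t) <= K t and
   E(y) - phi(t) <= K^2 t. EVI integrated over [0, t] with an arbitrary test
   point x, divided by t as t -> 0, then reads
     E(y) - E(x) <= K d(y, x) + k d(y, x)^2 / 2. *)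
Require Import Defs.
From HB Require Import structures.
From mathcomp Require Import all_boot all_order all_algebra.
From mathcomp Require Import all_classical all_reals all_analysis.
From mathcomp Require Import measurable_realfun.
From mathcomp Require Import ring lra.

Set Implicit Arguments.
Unset Strict Implicit.
Unset Printing Implicit Defensive.

Import Order.TTheory GRing.Theory Num.Theory.
Import numFieldNormedType.Exports.

Local Open Scope classical_set_scope.
Local Open Scope ereal_scope.

Section mdist_realType.
Context {R : realType} {X : metricType R}.
Local Open Scope ring_scope.

(* [metric_sym] and [metric_triangle] elaborated at a realType, so that [lra]
   identifies the distances. *)
Lemma mdistC (x y : X) : mdist x y = mdist y x.
Proof. exact: metric_sym. Qed.

Lemma mdist_triangle (x y z : X) : mdist x z <= mdist x y + mdist y z.
Proof. exact: metric_triangle. Qed.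

End mdist_realType.

(** * Dini derivatives and Gronwall's inequality *)

Section dini.
Context {R : realType}.
Local Open Scope ring_scope.
Implicit Types (f beta : R -> R) (a b k : R).

(** For a slack slope [e > 0], the supremum of the times [t] with [f t <= f a + e * (t - a)] is
    again such a time, by lower semicontinuity from the left. If it were below [b], the Dini
    condition would produce a later one. Then [e] tends to 0. *)
Lemma le_of_dini f a b : a <= b ->
  (forall t, a < t <= b -> forall e, 0 < e ->
    \forall s \near t^'-, f t <= f s + e) ->
  (forall t, a <= t < b -> forall e d, 0 < e -> 0 < d ->
    exists2 u, 0 < u < d & f (t + u) <= f t + e * u) ->
  f b <= f a.
Proof.
move=> ab flsc fdini.
suff H e : 0 < e -> f b <= f a + e * (b - a).
  have [<-//|ab'] := eqVneq a b.
  have ab0 : 0 < b - a by rewrite subr_gt0 lt_neqAle ab' ab.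
  apply/ler_addgt0Pl => e e0; rewrite addrC.
  have /le_trans -> // := H (e / (b - a)) (divr_gt0 e0 ab0).
  by rewrite divfK // gt_eqF.
move=> e0.
pose S := [set t | a <= t <= b /\ f t <= f a + e * (t - a)].
have Sa : S a by split; [rewrite lexx ab | rewrite subrr mulr0 addr0].
have Sub : has_ubound S by exists b => t [/andP[]].
have aS : a <= sup S by exact: ub_le_sup.
have Sb : sup S <= b by apply: ge_sup; [exists a | move=> t [/andP[]]].
have SS : S (sup S).
  split; first by rewrite aS Sb.
  have [<-|aS'] := eqVneq a (sup S); first by rewrite subrr mulr0 addr0.
  have aS0 : a < sup S by rewrite lt_neqAle aS' aS.
  apply/ler_addgt0Pl => e' e'0.
  have tS : a < sup S <= b by rewrite aS0 Sb.
  have [d /= d0 Hd] := flsc _ tS _ e'0.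
  have [|t [/andP[at_ tb] ft] dt] := @sup_adherent _ S d d0.
    by split => //; exists a.
  have tS' : t <= sup S by apply: ub_le_sup => //; split=> //; rewrite at_ tb.
  have [<-|tnS] := eqVneq t (sup S); first by lra.
  have tltS : t < sup S by rewrite lt_neqAle tnS tS'.
  have /Hd : `|sup S - t| < d by rewrite gtr0_norm; lra.
  move=> /(_ tltS) fS.
  have : e * (t - a) <= e * (sup S - a) by rewrite ler_pM2l //; lra.
  by lra.
have [Sltb|] := ltP (sup S) b; last first.
  move=> bS; have SE : sup S = b by apply/eqP; rewrite eq_le Sb bS.
  by case: SS => _; rewrite SE.
case: SS => _ fS.
have tS : a <= sup S < b by rewrite aS Sltb.
have [|u /andP[u0 ub] fu] := fdini _ tS e (b - sup S) e0; first by rewrite subr_gt0.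
suff /(ub_le_sup Sub) : S (sup S + u) by lra.
split; first by apply/andP; split; lra.
by lra.
Qed.

(** [le_of_dini] applies to [expR (- k * (t - a)) * f t - beta t], because
    [expR (- k * u) * (1 + k * u) <= 1]. The forcing enters through increments of the nondecreasing
    [beta], which a weight at most 1 can only diminish. *)
Lemma gronwall f beta a b k : a <= b -> 0 <= k ->
  (forall t, a <= t <= b -> 0 <= f t) ->
  (forall t, a < t <= b -> f s @[s --> t^'-] --> f t) ->
  (forall t, a < t <= b -> beta s @[s --> t^'-] --> beta t) ->
  (forall s t, a <= s -> s <= t -> beta s <= beta t) ->
  (forall t, a <= t < b -> forall e, 0 < e -> \forall s \near t^'+,
     f s <= f t + (k * f t + e) * (s - t) + (beta s - beta t)) ->
  f b <= expR (k * (b - a)) * (f a + (beta b - beta a)).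
Proof.
move=> ab k0 f0 cf cbeta hbeta fd.
pose F t := expR (- k * (t - a)) * f t - beta t.
have : F b <= F a.
  apply: le_of_dini => //.
  - move=> t tab e e0.
    have : F s @[s --> t^'-] --> F t.
      apply: cvgB; last exact: cbeta.
      apply: cvgM; last exact: cf.
      apply: cvg_at_left_filter.
      apply: (@continuous_comp _ _ _ (fun x => - k * (x - a)) expR).
        by apply: cvgM; [exact: cvg_cst | apply: cvgB; [exact: cvg_id | exact: cvg_cst]].
      exact: continuous_expR.
    move=> /cvgrPdist_le /(_ _ e0); apply: filterS => s.
    by rewrite ler_distlC => /andP[]; rewrite lerBlDr.
  - move=> t tab e d e0 d0.
    have [r /= r0 Hr] := fd t tab e e0.
    have m0 : 0 < Num.min (Num.min (r / 2) (d / 2)) (b - t).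
      by rewrite !lt_min !divr_gt0 //= subr_gt0; case/andP: tab.
    set u := Num.min _ _ in m0.
    have ur : u <= r / 2 by rewrite /u !ge_min lexx.
    have ud : u <= d / 2 by rewrite /u !ge_min lexx orbT.
    exists u; first by rewrite m0; lra.
    have /Hr : `|t - (t + u)| < r by rewrite opprD addNKr normrN gtr0_norm; lra.
    rewrite ltrDl => /(_ m0) fu.
    have ft : 0 <= f t by apply: f0; case/andP: tab => -> /ltW.
    have bu : 0 <= beta (t + u) - beta t by rewrite subr_ge0; apply: hbeta; lra.
    have at_ : a <= t by case/andP: tab.
    have E1 : expR (- k * (t - a)) <= 1 by rewrite expR_le1 mulNr oppr_le0 mulr_ge0 //; lra.
    have E2 : expR (- k * u) <= 1 by rewrite expR_le1 mulNr oppr_le0 mulr_ge0 //; lra.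
    have E3 : expR (- k * u) * (1 + k * u) <= 1.
      by rewrite mulNr expRN mulrC ler_pdivrMr ?expR_gt0 // mul1r expR_ge1Dx.
    have p1 := expR_gt0 (- k * (t - a)); have p2 := expR_gt0 (- k * u).
    rewrite /F.
    have -> : - k * (t + u - a) = - k * (t - a) + - k * u by ring.
    rewrite expRD.
    set A := expR _ in E1 p1 *; set B := expR _ in E2 E3 p2 *.
    have H1 : f (t + u) <= f t * (1 + k * u) + (e * u + (beta (t + u) - beta t)).
      by move: fu; rewrite (addrC t) addrK; lra.
    have H2 : A * B * f (t + u) <= A * B * (f t * (1 + k * u) + (e * u + (beta (t + u) - beta t))).
      by rewrite ler_pM2l // mulr_gt0.
    have H3 : A * (f t * (B * (1 + k * u))) <= A * (f t * 1).
      by rewrite ler_pM2l // ler_wpM2l.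
    have eu : 0 <= e * u by rewrite mulr_ge0 // ltW.
    have H4 : A * B * (e * u + (beta (t + u) - beta t)) <= 1 * (e * u + (beta (t + u) - beta t)).
      by apply: ler_wpM2r; [exact: addr_ge0 | apply: mulr_ile1 => //; exact: ltW].
    by rewrite -subr_ge0 in H2; rewrite -subr_ge0 in H3; lra.
rewrite /F subrr mulr0 expR0 mul1r => H.
have -> : k * (b - a) = - (- k * (b - a)) by ring.
rewrite expRN mulrC ler_pdivlMr ?expR_gt0 // mulrC.
by lra.
Qed.

End dini.

(** * Length of curves *)

Section nonmeasurable_integral.
Local Open Scope ring_scope.
Local Open Scope ereal_scope.
Import HBNNSimple.

(* [metric_derivative] need not be measurable a priori, hence this variant of
   [ge0_le_integral]. *)
Lemma ge0_le_integral_nonmeasurable d (T : measurableType d) (R : realType)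
    (mu : {measure set T -> \bar R}) (D : set T) (f1 f2 : T -> \bar R) :
  (forall x, D x -> 0 <= f1 x) -> (forall x, D x -> f1 x <= f2 x) ->
  \int[mu]_(x in D) f1 x <= \int[mu]_(x in D) f2 x.
Proof.
move=> f10 f12.
have f20 x : D x -> 0 <= f2 x by move=> Dx; rewrite (le_trans (f10 _ Dx)) // f12.
rewrite !ge0_integralE //.
apply: ereal_sup_le => _ [h hf <-]; exists h => // x.
by rewrite (le_trans (hf x)) // lee_restrict.
Qed.

End nonmeasurable_integral.

Section length.
Context {R : realType} {X : metricType R}.
Local Open Scope ring_scope.
Implicit Types (c : R -> X) (Y : set X).
Local Notation mu := (@lebesgue_measure R).

(** A limsup along a filter containing the empty set would be [-oo]. Every punctured neighbourhood
    of [t] meets [[0, 1]], on the right or on the left of [t] according to its position relative to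
    1/2. *)
Lemma metric_derivative_ge0 c (t : R) : 0 <= t <= 1 ->
  (0 <= metric_derivative `[0%R, 1%R] c t)%E.
Proof.
move=> /andP[t0 t1]; apply: limf_esup_ge0; last first.
  by move=> s; rewrite lee_fin divr_ge0 ?mdist_ge0.
move=> [e /= e0 He].
have m0 : 0 < Num.min (e / 2) (1 / 2) by rewrite lt_min !divr_gt0.
set u := Num.min _ _ in m0.
have ue : u <= e / 2 by rewrite /u ge_min lexx.
have u1 : u <= 1 / 2 by rewrite /u ge_min lexx orbT.
have [th|th] := leP t (1 / 2).
- apply: (He (t + u)).
  + by rewrite /= opprD addNKr normrN gtr0_norm //; lra.
  + by apply/eqP => tE; lra.
  + by rewrite /= in_itv /=; apply/andP; split; lra.
- apply: (He (t - u)).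
  + by rewrite /= opprB addrC subrK gtr0_norm //; lra.
  + by apply/eqP => tE; lra.
  + by rewrite /= in_itv /=; apply/andP; split; lra.
Qed.

Lemma metric_derivative_le_lipschitz c (L : R) (t : R) : 0 <= t <= 1 ->
  (forall r q, 0 <= r -> r <= q -> q <= 1 -> (mdist (c r) (c q) <= L * (q - r))%R) ->
  (metric_derivative `[0%R, 1%R] c t <= L%:E)%E.
Proof.
move=> /andP[t0 t1] cL; apply: ge_ereal_inf.
exists (ereal_sup [set (mdist (c s) (c t) / `|s - t|)%:E | s in [set s | s != t /\ 0 <= s <= 1]]).
  exists [set s : R | s != t /\ 0 <= s <= 1] => //.
  by exists 1 => //= s _ st; rewrite in_itv.
apply: ge_ereal_sup => _ [s /= [st /andP[s0 s1]] <-].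
have st0 : 0 < `|s - t| by rewrite normr_gt0 subr_eq0.
rewrite lee_fin ler_pdivrMr //.
have [h|h] := leP s t.
  by rewrite distrC ger0_norm ?subr_ge0 // cL.
by rewrite ger0_norm ?subr_ge0 ?(ltW h) // mdistC cL // ltW.
Qed.

(** The constant [L] serves both as the majorant in [AC_curve] and as a bound on the metric
    derivative. *)
Lemma length_dist_le_lipschitz Y c (L : R) :
  (forall t : R, 0 <= t <= 1 -> Y (c t)) ->
  (forall r q, 0 <= r -> r <= q -> q <= 1 -> (mdist (c r) (c q) <= L * (q - r))%R) ->
  (length_dist Y (c 0%R) (c 1%R) <= L%:E)%E.
Proof.
move=> Yc cL.
apply: (@le_trans _ _ (\int[mu]_(t in `[0%R, 1%R]) (cst L%:E) t)%E); last first.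
  by rewrite integral_cst //= lebesgue_measure_itv /= lte_fin ltr01 oppr0 adde0 mule1.
apply: (@le_trans _ _ (\int[mu]_(t in `[0%R, 1%R]) metric_derivative `[0%R, 1%R] c t)%E).
  apply: ereal_inf_lbound => /=; exists c => //; split => //.
  exists (cst L).
    apply/Lfun1_integrable.
    rewrite -restrict_EFin; apply/integrable_restrict => //=.
    rewrite setTI; apply/integrableP; split; first exact/measurable_EFinP/measurable_cst.
    by rewrite /= integral_cst //= lebesgue_measure_itv /= lte_fin ltr01 oppr0 adde0 mule1 ltry.
  move=> s t; rewrite /= !in_itv /= => /andP[s0 s1] /andP[t0 t1] st.
  rewrite Rintegral_cst //= lebesgue_measure_itv /= lte_fin st -EFinD /=.
  by apply: cL => //; exact: ltW.
apply: ge0_le_integral_nonmeasurable => t; rewrite /= in_itv /= => t01.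
  exact: metric_derivative_ge0.
exact: metric_derivative_le_lipschitz.
Qed.

Lemma length_dist_le_lipschitz_itv Y c (L : R) (a b : R) : a <= b ->
  (forall t : R, a <= t <= b -> Y (c t)) ->
  (forall r q, a <= r -> r <= q -> q <= b -> (mdist (c r) (c q) <= L * (q - r))%R) ->
  (length_dist Y (c a) (c b) <= (L * (b - a))%:E)%E.
Proof.
move=> ab Yc cL.
have := @length_dist_le_lipschitz Y (fun r => c (a + r * (b - a))) (L * (b - a)).
rewrite /= mul0r addr0 mul1r (_ : a + (b - a) = b); last by ring.
apply.
- move=> t /andP[t0 t1]; apply: Yc; apply/andP; split.
    by rewrite lerDl mulr_ge0 // subr_ge0.
  by rewrite -lerBrDl ler_piMl // subr_ge0.
- move=> r q r0 rq q1.
  have -> : L * (b - a) * (q - r) = L * (a + q * (b - a) - (a + r * (b - a))) by ring.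
  apply: cL.
  + by rewrite lerDl mulr_ge0 // subr_ge0.
  + by rewrite lerD2l ler_wpM2r // subr_ge0.
  + by rewrite -lerBrDl ler_piMl // subr_ge0.
Qed.

End length.

(** * Integrals of difference quotients of a monotone function *)

Section difference_quotients.
Context {R : realType}.
Local Open Scope ring_scope.
Local Notation mu := (@lebesgue_measure R).

(** With [K] a primitive of [k] and [F t := K (t + d) - K t], the integral equals [(F 1 - F 0) / d].
    Here [F 1 <= k 1 * d] because [k] is constant after 1, and [F 0 >= k 0 * d] by monotonicity. *)
Lemma integral_difference_quotient_le (k : R -> R) (d : R) :
  {homo k : x y / x <= y} ->
  (forall x : R, -1 < x < 3 -> {for x, continuous k}) ->
  (forall x : R, 1 <= x -> k x = k 1) -> 0 < d -> d <= 1 ->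
  (\int[mu]_(t in `]0%R, 1%R[) ((k (t + d)%R - k t)%R / d)%:E <= (k 1 - k 0)%:E)%E.
Proof.
move=> hk ck k1 d0 d1.
(* Any interval inside []-1, 3[] with [[0, 2]] in its interior would do, as [t + d] stays in
   [[0, 2]]. *)
pose a : R := - (1 / 2); pose b : R := 5 / 2.
have ab : a < b by rewrite /a /b; lra.
have ckab : {within `[a, b], continuous k}.
  apply: continuous_in_subspaceT => x; rewrite inE /= in_itv /= => /andP[ax xb].
  by apply: ck; rewrite /a /b in ax xb; apply/andP; split; lra.
have ik : mu.-integrable `[a, b] (EFin \o k).
  by apply: continuous_compact_integrable => //; exact: segment_compact.
pose K x := \int[mu]_(t in `[a, x]) k t.
have dK x : a < x < b -> is_derive x 1 K (k x).
  move=> /andP[ax xb].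
  have ckx : {for x, continuous k} by apply: ck; rewrite /a /b in ax xb; apply/andP; split; lra.
  have [dKx K'x] := continuous_FTC1_closed xb ik ax ckx.
  by apply: (DeriveDef dKx); rewrite -derive1E.
pose F t := K (t + d) - K t.
have dF t : a < t -> t + d < b -> is_derive t 1 F (k (t + d) - k t).
  move=> at_ tb; apply: is_deriveB; last by apply: dK; rewrite at_; lra.
  have -> : k (t + d) = k (t + d) * (1 + 0) by rewrite addr0 mulr1.
  apply: (@is_derive1_comp _ K (fun t => t + d)).
  by apply: dK; rewrite tb; lra.
have cK x : a < x < b -> {for x, continuous K}.
  move=> /dK dKx; apply: differentiable_continuous; apply/derivable1_diffP.
  exact: ex_derive.
have cF t : a < t -> t + d < b -> {for t, continuous F}.
  move=> at_ tb; apply: differentiable_continuous; apply/derivable1_diffP.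
  by have ? := dF _ at_ tb; exact: ex_derive.
have inc s t : a < s -> s < t -> t < b ->
    exists2 c, s < c < t & K t - K s = k c * (t - s).
  move=> as_ st tb; have [||c + ->] := @MVT R K k s t st.
  - move=> x; rewrite in_itv /= => /andP[sx xt]; apply: dK.
    by apply/andP; split; lra.
  - apply: continuous_in_subspaceT => x; rewrite inE /= in_itv /= => /andP[sx xt].
    by apply: cK; apply/andP; split; lra.
  - by rewrite in_itv /= => sct; exists c.
have aE : a = - (1 / 2) by []. have bE : b = 5 / 2 by [].
have F1 : F 1 <= k 1 * d.
  have [|||c /andP[c1 _]] := inc 1 (1 + d); [by lra|by lra|by lra|].
  by move=> HF; rewrite /F HF (k1 c (ltW c1)); lra.
have F0 : k 0 * d <= F 0.
  have [|||c /andP[c0 _]] := inc 0 d; [by lra|by lra|by lra|].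
  rewrite subr0 /F add0r => ->; rewrite ler_pM2r //; apply: hk; exact: ltW.
have ckd t : a < t -> t + d < b -> {for t, continuous (fun t => k (t + d))}.
  move=> at_ tb.
  apply: (cvg_comp (fun s : R => s + d) k).
    by apply: cvgD; [exact: cvg_id | exact: cvg_cst].
  by apply: ck; apply/andP; split; lra.
have cfd t : a < t -> t + d < b -> {for t, continuous (fun t => k (t + d) - k t)}.
  move=> at_ tb; apply: cvgB; first exact: ckd.
  by apply: ck; apply/andP; split; lra.
have I : (\int[mu]_(t in `[0%R, 1%R]) (k (t + d)%R - k t)%:E = (F 1)%:E - (F 0)%:E)%E.
  apply: continuous_FTC2 => //.
  - apply: continuous_in_subspaceT => x; rewrite inE /= in_itv /= => /andP[sx xt].
    by apply: cfd; lra.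
  - split.
    + move=> x; rewrite in_itv /= => /andP[sx xt].
      have ax : a < x by lra. have xb : x + d < b by lra.
      by have ? := dF _ ax xb; exact: ex_derive.
    + by apply: cvg_at_right_filter; apply: cF; lra.
    + by apply: cvg_at_left_filter; apply: cF; lra.
  - move=> x; rewrite in_itv /= => /andP[sx xt].
    have ax : a < x by lra. have xb : x + d < b by lra.
    by have ? := dF _ ax xb; rewrite derive1E derive_val.
have mfd : measurable_fun (`]0, 1[ : set R) (fun t : R => k (t + d) - k t).
  apply: open_continuous_measurable_fun; first exact: interval_open.
  move=> x; rewrite inE /= in_itv /= => /andP[sx xt].
  by apply: cfd; lra.
rewrite integral_itv_bndoo in I; last exact/measurable_EFinP.
under eq_integral do rewrite mulrC EFinM.
rewrite ge0_integralZl_EFin //; last 3 first.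
- by move=> x _; rewrite lee_fin subr_ge0; apply: hk; rewrite lerDl ltW.
- exact/measurable_EFinP.
- by rewrite invr_ge0 ltW.
rewrite I -EFinB -EFinM lee_fin mulrC ler_pdivrMr //.
by lra.
Qed.

(** Fatou's lemma along the steps [1 / (n + 1)]: the bound for a fixed step does not depend on
    [n]. *)
Lemma integral_liminf_quotient_le (k : R -> R) :
  {homo k : x y / x <= y} ->
  (forall x : R, -1 < x < 3 -> {for x, continuous k}) ->
  (forall x : R, 1 <= x -> k x = k 1) ->
  (\int[mu]_(t in `]0%R, 1%R[)
     limn_einf (fun n => ((k (t + n.+1%:R^-1)%R - k t)%R / n.+1%:R^-1)%:E)
   <= (k 1 - k 0)%:E)%E.
Proof.
move=> hk ck k1.
have n1 n : n.+1%:R^-1 <= 1 :> R by rewrite invf_le1 // ler1n.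
pose h n t : \bar R := ((k (t + n.+1%:R^-1) - k t) / n.+1%:R^-1)%:E.
apply: (@le_trans _ _ (limn_einf (fun n => \int[mu]_(x in `]0%R, 1%R[) h n x)))%E.
  apply: fatou => //.
  - move=> n; apply/measurable_EFinP.
    apply: open_continuous_measurable_fun; first exact: interval_open.
    move=> x; rewrite inE /= in_itv /= => /andP[sx xt].
    have := n1 n; have : 0 < n.+1%:R^-1 :> R by rewrite invr_gt0.
    rewrite /h; move: (n.+1%:R^-1) => d d0 d1.
    apply: cvgMr_tmp; apply: cvgB.
      apply: (cvg_comp (fun s : R => s + d) k).
        by apply: cvgD; [exact: cvg_id | exact: cvg_cst].
      by apply: ck; apply/andP; split; lra.
    by apply: ck; apply/andP; split; lra.
  - move=> n x _; rewrite lee_fin; apply: divr_ge0; last by rewrite invr_ge0.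
    by rewrite subr_ge0; apply: hk; rewrite lerDl invr_ge0.
rewrite limn_einf_lim; apply: lime_le; first exact: is_cvg_einfs.
apply: nearW => n; apply: ge_ereal_inf.
exists (\int[mu]_(x in `]0%R, 1%R[) h n x)%E; first by exists n => /=.
by apply: integral_difference_quotient_le => //; rewrite invr_gt0.
Qed.

End difference_quotients.

(** * The distance between endpoints and the integral of the metric derivative *)

Section metric_derivative_integral.
Context {R : realType} {X : metricType R}.
Local Open Scope ring_scope.
Local Notation mu := (@lebesgue_measure R).

Lemma limn_einf_ge (u : (\bar R)^nat) (l : \bar R) :
  (\forall n \near \oo, (l <= u n)%E) -> (l <= limn_einf u)%E.
Proof.
move=> lu; rewrite /limn_einf /limn_esup -/(limf_einf u \oo) limf_einfE.
apply: le_ereal_sup_tmp; exists (ereal_inf [set u n | n in [set n | (l <= u n)%E]]).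
  by exists [set n | (l <= u n)%E].
by apply: le_ereal_inf_tmp => _ [n /= + <-].
Qed.

(* Let [M] be the primitive of the majorant [m] and [k t] be
   [M t - d(c 0, c t)], which is nondecreasing. Fatou's lemma, applied to the
   difference quotients of [k], gives [int_0^1 liminf k_n <= k 1 - k 0], while
   Lebesgue's differentiation theorem gives
   [m - liminf k_n <= metric_derivative] almost everywhere. *)
Lemma mdist_le_integral_metric_derivative (c : R -> X) :
  AC_curve 1 `[0%R, 1%R] c ->
  ((mdist (c 0%R) (c 1%R))%:E <=
   \int[mu]_(t in `[0%R, 1%R]) metric_derivative `[0%R, 1%R] c t)%E.
Proof.
move=> [m mL cm].
pose m0 : R -> R := m \_ `[0%R, 1%R].
have im0 : mu.-integrable setT (EFin \o m0) by exact/Lfun1_integrable.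
have im0S (A : set R) : measurable A -> mu.-integrable A (EFin \o m0).
  by move=> mA; apply: integrableS im0.
(* Integrating from -1 keeps 0 away from the endpoint, and [m0] vanishing off [[0, 1]] makes [M]
   constant before 0 and after 1. *)
pose M (x : R) : R := \int[mu]_(t in `[-1, x]) m0 t.
have MB (s t : R) : -1 <= s -> s <= t -> M t - M s = \int[mu]_(u in `]s, t]) m0 u.
  by move=> s1 st; apply: Rintegral_itvB => //; exact: im0S.
have m0E (u : R) : 0 <= u <= 1 -> m0 u = m u.
  by move=> u01; rewrite /m0 patchE mem_set //= in_itv.
have m0out (u : R) : ~~ (0 <= u <= 1) -> m0 u = 0.
  by move=> u01; rewrite /m0 patchE memNset //= in_itv; exact/negP.
have M0 (x : R) : x <= 0 -> M x = 0.
  move=> x0; rewrite /M -Rintegral_itv_bndo_bndc; last exact: im0S.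
  rewrite (@eq_Rintegral _ _ _ mu _ (cst 0)) ?Rintegral_cst ?mul0r // => u.
  rewrite inE /= in_itv /= => /andP[_ ux]; apply: m0out.
  by rewrite leNgt (lt_le_trans ux).
have M1 (x : R) : 1 <= x -> M x = M 1.
  move=> x1; apply/eqP; rewrite -subr_eq0 MB //.
  rewrite (@eq_Rintegral _ _ _ mu _ (cst 0)) ?Rintegral_cst ?mul0r // => u.
  rewrite inE /= in_itv /= => /andP[ux _]; apply: m0out.
  by rewrite negb_and -!ltNge ux orbT.
have cM (s t : R) : 0 <= s -> s <= t -> t <= 1 -> mdist (c s) (c t) <= M t - M s.
  move=> s0; rewrite le_eqVlt => /predU1P[<- _|st t1].
    by rewrite mdistxx subrr.
  rewrite MB; [|lra|exact: ltW].
  rewrite Rintegral_itv_obnd_cbnd; last exact: im0S.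
  rewrite (@eq_Rintegral _ _ _ mu _ m) => [|u]; last first.
    by rewrite inE /= in_itv /= => /andP[su ut]; apply: m0E; apply/andP; split; lra.
  by apply: cm => //; rewrite /= in_itv /=; apply/andP; split; lra.
(* The values of [c] outside [[0, 1]] are arbitrary; clamping the parameter extends the distance
   function to the line consistently with [M]. *)
pose cl x : R := Num.max 0 (Num.min x 1).
have clE x : 0 <= x <= 1 -> cl x = x.
  by move=> /andP[x0 x1]; rewrite /cl min_l // max_r.
have cl01 x : 0 <= cl x <= 1.
  by rewrite /cl le_max lexx ge_max ler01 ge_min lexx orbT.
have cl_le s t : s <= t -> cl s <= cl t.
  by move=> st; rewrite /cl ge_max !le_max lexx /= le_min !ge_min lexx st /= !orbT.
have Mcl x : M (cl x) = M x.
  have [x0|x0] := leP x 0.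
    by rewrite /cl min_l ?max_l ?M0 //; lra.
  have [x1|x1] := leP x 1; first by rewrite clE // x1 ltW.
  by rewrite /cl min_r ?max_r ?ler01 ?ltW // (M1 x) // ltW.
pose f x := mdist (c 0) (c (cl x)).
have fM s t : s <= t -> `|f t - f s| <= M t - M s.
  move=> st; rewrite -Mcl -(Mcl s).
  have /andP[s0 s1] := cl01 s; have /andP[t0 t1] := cl01 t.
  have := cM _ _ s0 (cl_le _ _ st) t1.
  have := mdist_triangle (c 0) (c (cl s)) (c (cl t)).
  have := mdist_triangle (c 0) (c (cl t)) (c (cl s)).
  rewrite (mdistC (c (cl t)) (c (cl s))) -/(f t) -/(f s) => h1 h2 h3.
  rewrite ler_norml; move: h1 h2 h3.
  move: (mdist _ _) (f t) (f s) (M _) (M _) => p q r u w; clear.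
  by move=> *; apply/andP; split; lra.
have Mmono s t : s <= t -> M s <= M t.
  by move=> /fM /(le_trans (normr_ge0 _)); rewrite subr_ge0.
have contM x : -1 < x < 3 -> {for x, continuous M}.
  move=> x13; have l13 : -1 < 3 :> R by lra.
  have := parameterized_integral_continuous (ltW l13) (im0S _ (measurable_itv _)).
  by move=> /(continuous_within_itvP _ l13)[cM' _ _]; apply: cM'; rewrite in_itv.
have contf x : -1 < x < 3 -> {for x, continuous f}.
  move=> /contM /cvgrPdist_le cMx; apply/cvgrPdist_le => e e0.
  have := cMx e e0; apply: filterS => s; apply: le_trans.
  have [xs|sx] := leP x s.
    by rewrite distrC (distrC (M x)) (ger0_norm (_ : 0 <= M s - M x)) ?subr_ge0 ?Mmono // fM.
  by rewrite (ger0_norm (_ : 0 <= M x - M s)) ?subr_ge0 ?Mmono ?fM // ltW.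
pose k x := M x - f x.
have hk : {homo k : x y / x <= y}.
  by move=> x y /fM; rewrite ler_norml /k => /andP[_]; lra.
have ck x : -1 < x < 3 -> {for x, continuous k}.
  by move=> x13; apply: cvgB; [exact: contM | exact: contf].
have k1 x : 1 <= x -> k x = k 1.
  by move=> x1; rewrite /k M1 // /f /cl !min_r.
have Hh := integral_liminf_quotient_le hk ck k1.
pose d n : R := n.+1%:R^-1.
have d0 n : 0 < d n by rewrite invr_gt0.
pose h t := limn_einf (fun n => ((k (t + d n) - k t) / d n)%:E).
have h0 t : (0 <= h t)%E.
  apply: limn_einf_ge; apply: nearW => n; rewrite lee_fin divr_ge0 ?(ltW (d0 n)) //.
  by rewrite subr_ge0 hk // lerDl ltW.
have mh : measurable_fun (`]0, 1[ : set R) h.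
  apply: measurableT_comp => //; apply: measurable_fun_limn_esup => n.
  apply: measurableT_comp => //; apply/measurable_EFinP.
  apply: open_continuous_measurable_fun; first exact: interval_open.
  move=> x; rewrite inE /= in_itv /= => /andP[x0 x1].
  have dn : d n <= 1 by rewrite /d invf_le1 // ler1n.
  have dn0 := d0 n.
  move: (d n) dn dn0 => e e1 e0.
  apply: cvgMr_tmp; apply: cvgB.
    apply: (cvg_comp (fun s : R => s + e) k).
      by apply: cvgD; [exact: cvg_id | exact: cvg_cst].
    by apply: ck; apply/andP; split; lra.
  by apply: ck; apply/andP; split; lra.
(* Suppose the metric derivative [gr] is below [w = m0 t - h t]. With [G] midway and
   [w - G = 2 * e], for small steps the quotients of [M] exceed [m0 t - e] and those of the distance
   are at most [G]. Those of [k] are then at least [h t + e], against the definition of [h t] as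
   their liminf. *)
have ptw t : 0 < t < 1 -> derivable M t 1 -> derive1 M t = m0 t ->
    ((m0 t)%:E - h t <= metric_derivative `[0%R, 1%R] c t)%E.
  move=> /andP[t0 t1] dM M't; rewrite leNgt; apply/negP.
  have t01 : 0 <= t <= 1 by rewrite !ltW.
  have := metric_derivative_ge0 c t01; have := h0 t.
  case hE : (h t) => [hr| |] // _; last by rewrite ltNge leNye.
  case gE : (metric_derivative _ _ _) => [gr| |] // _;
    rewrite -EFinB ?lte_fin ?ltNge ?leey // => gw.
  pose w := m0 t - hr; pose G := (gr + w) / 2; pose e := (w - G) / 2.
  have e0 : 0 < e by rewrite /e /G /w; lra.
  have [_ [V [r1 /= r10 HV] <-] VG] : exists2 y,
      [set ereal_sup ((fun s : R => (mdist (c s) (c t) / `|s - t|)%:E) @` V)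
        | V in within `[0%R, 1%R] t^'] y & (y < G%:E)%E.
    apply: ereal_inf_lt; rewrite -/(limf_esup _ _) -/(metric_derivative _ c t) gE.
    by rewrite lte_fin /G /w; lra.
  have C : h^-1 *: (M (h + t) - M t) @[h --> 0^'] --> m0 t.
    rewrite -M't; move: dM; rewrite /derivable => /cvg_ex [l Hl].
    have Hl' : h^-1 *: (M (h + t) - M t) @[h --> 0^'] --> l.
      by move: Hl; apply: cvg_trans; apply: near_eq_cvg; near=> y; rewrite [y *: 1]mulr1.
    by rewrite /derive1 (cvg_lim _ Hl').
  have [r2 /= r20 HC] := (cvgrPdist_lt _ _).1 C _ e0.
  have r0 : 0 < Num.min (1 - t) (Num.min r1 r2) by rewrite !lt_min subr_gt0 t1 r10.
  have : ((m0 t - e - G)%:E <= h t)%E.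
    apply: limn_einf_ge.
    apply: filterS (near_infty_natSinv_lt (PosNum r0)) => n.
    rewrite /= -/(d n) !lt_min => /and3P[d1t dr1 dr2].
    have dn0 := d0 n.
    rewrite lee_fin ler_pdivlMr //.
    have h1 : `|m0 t - (d n)^-1 * (M (d n + t) - M t)| < e.
      by apply: HC; rewrite /= ?sub0r ?normrN ?gtr0_norm // gt_eqF.
    have h2 : mdist (c (t + d n)) (c t) <= G * d n.
      have Vs : V (t + d n).
        apply: HV => /=.
        - by rewrite opprD addNKr normrN gtr0_norm.
        - by rewrite gt_eqF // ltrDl.
        - by rewrite in_itv /=; apply/andP; split; lra.
      have : ((mdist (c (t + d n)) (c t) / `|t + d n - t|)%:E < G%:E)%E.
        by apply: le_lt_trans VG; apply: ereal_sup_ubound; exists (t + d n).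
      rewrite lte_fin (_ : t + d n - t = d n); last by ring.
      by rewrite gtr0_norm // ltr_pdivrMr // => /ltW.
    have h3 : f (t + d n) - f t <= mdist (c (t + d n)) (c t).
      rewrite /f !clE //; last by apply/andP; split; lra.
      have := mdist_triangle (c 0) (c t) (c (t + d n)).
      by rewrite (mdistC (c t) (c (t + d n))); lra.
    have h4 : (m0 t - e) * d n <= M (t + d n) - M t.
      move: h1; rewrite ltr_norml => /andP[_ h1].
      rewrite -ler_pdivlMr // mulrC (addrC t); lra.
    by rewrite /k; lra.
  by rewrite hE lee_fin /e /G /w; rewrite /e /G /w in e0; lra.
(* Lebesgue differentiation; the null set [N] contains the exceptional points and is removed from
   the domain of integration. *)
have [N [mN N0 HN]] : {ae mu, forall x, -1 < x -> derivable M x 1 /\ derive1 M x = m0 x}.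
  have lm0 : locally_integrable [set: R] m0.
    by apply: open_integrable_locally => //; exact: openT.
  have := @FTC1 R m0 (BLeft (-1)) (fun y => im0S _ (measurable_itv _)) lm0.
  apply: filterS; first exact: (ae_filter_ringOfSetsType mu).
  move=> x Hx x1; apply: Hx.
  by rewrite lte_fin.
have m01 : measurable (`]0, 1[ : set R) by exact: measurable_itv.
pose D := `]0, 1[%classic `\` N.
have mD : measurable D by exact: measurableD.
have D01 : D `<=` `]0, 1[ by move=> x [].
have ih : mu.-integrable D h.
  apply: (@integrableS _ _ _ mu `]0, 1[) => //.
  apply/integrableP; split => //.
  under eq_integral do rewrite gee0_abs //.
  by apply: (le_lt_trans Hh); rewrite ltry.
have Dh : (\int[mu]_(t in D) h t <= (k 1 - k 0)%:E)%E.
  by apply: le_trans Hh; apply: ge0_subset_integral => // x _; exact: h0.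
have Dm : (\int[mu]_(t in D) (m0 t)%:E = (M 1)%:E)%E.
  rewrite /D -negligible_integral //; last exact: im0S.
  have M01 : M 1 = \int[mu]_(u in `]0, 1]) m0 u.
    by rewrite -MB // ?(M0 0) // ?subr0 //; lra.
  rewrite M01.
  rewrite /Rintegral fineK; last first.
    by apply: integrable_fin_num => //; exact: im0S.
  rewrite integral_itv_bndo_bndc //.
  exact: (measurable_int mu (im0S _ (measurable_itv _))).
(* As [M 0 = 0], the distance from [c 0] to [c 1] is [M 1 - (k 1 - k 0)]. *)
apply: (@le_trans _ _ (\int[mu]_(t in D) ((m0 t)%:E - h t))%E).
  rewrite (integralB _ (im0S _ mD) ih) // Dm.
  apply: (@le_trans _ _ ((M 1)%:E - (k 1 - k 0)%:E)%E).
    rewrite -EFinB lee_fin /k /f !clE ?lexx ?ler01 // mdistxx (M0 0) //.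
    by lra.
  by rewrite leeD2l // leeN2.
(* The difference may be negative. Its positive part on [D], extended by 0, lies below the metric
   derivative at every point of [[0, 1]], so monotonicity of the integral of nonnegative functions
   applies. *)
apply: (@le_trans _ _ (\int[mu]_(t in `[0%R, 1%R])
   ((fun t => maxe ((m0 t)%:E - h t) 0) \_ D) t))%E.
  rewrite -integral_mkcondr setIidr; last first.
    by move=> x /D01; apply: subset_itv_oo_cc.
  rewrite [leLHS]integralE.
  apply: (@le_trans _ _ (\int[mu]_(t in D) ((fun t => (m0 t)%:E - h t)^\+ t)%E)%E).
    by rewrite geeDl // oppe_le0 integral_ge0.
  by apply: ge0_le_integral_nonmeasurable => x _; [exact: funepos_ge0 | rewrite funeposE].
apply: ge0_le_integral_nonmeasurable => t; rewrite /= in_itv /= => t01.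
  by apply: erestrict_ge0 => x _; rewrite le_max lexx orbT.
rewrite patchE; case: ifPn => [|_]; last exact: metric_derivative_ge0.
rewrite inE => -[t01' Nt]; rewrite ge_max metric_derivative_ge0 // andbT.
rewrite /= in_itv /= in t01'.
have [] : -1 < t -> derivable M t 1 /\ derive1 M t = m0 t.
- by apply: contrapT => Ht; apply: Nt; exact: HN.
- by case/andP: t01' => t0 _; lra.
- exact: ptw.
Unshelve. all: by end_near. Qed.

End metric_derivative_integral.

(** * Curves satisfying the evolution variational inequality *)

Section evi_path.
Context {R : realType} {X : metricType R}.
Local Open Scope ring_scope.

Definition half_sqdist (x y : X) : R := mdist x y ^+ 2 / 2.

Lemma half_sqdist_ge0 x y : 0 <= half_sqdist x y.
Proof. by rewrite divr_ge0 // sqr_ge0. Qed.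

Lemma half_sqdistxx x : half_sqdist x x = 0.
Proof. by rewrite /half_sqdist mdistxx expr0n /= mul0r. Qed.

Lemma half_sqdistC x y : half_sqdist x y = half_sqdist y x.
Proof. by rewrite /half_sqdist mdistC. Qed.

Lemma half_sqdist_le0 x y : half_sqdist x y <= 0 -> x = y.
Proof.
move=> h; have /eqP : half_sqdist x y = 0.
  by apply/eqP; rewrite eq_le h half_sqdist_ge0.
by rewrite mulf_eq0 invr_eq0 pnatr_eq0 orbF sqrf_eq0 => /eqP/mdist_positivity.
Qed.

Lemma cvg_mdist {T : Type} {F : set_system T} {FF : Filter F} (f h : T -> X) x y :
  f @ F --> x -> h @ F --> y -> mdist (f t) (h t) @[t --> F] --> mdist x y.
Proof.
move=> fx hy; apply/cvgrPdist_le => e e0.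
have e2 : 0 < e / 2 by rewrite divr_gt0.
have Hf : \forall t \near F, mdist x (f t) <= e / 2.
  exact: metricType_numDomainType.cvgr_dist_le.
have Hh : \forall t \near F, mdist y (h t) <= e / 2.
  exact: metricType_numDomainType.cvgr_dist_le.
apply: filterS2 Hf Hh => t h1 h2.
have t1 := mdist_triangle x (f t) y.
have t2 := mdist_triangle (f t) (h t) y.
have t3 := mdist_triangle (f t) x (h t).
have t4 := mdist_triangle x y (h t).
rewrite (mdistC (h t)) in t2; rewrite (mdistC (f t) x) in t3.
by rewrite ler_norml; apply/andP; split; lra.
Qed.

Lemma cvg_half_sqdist {T : Type} {F : set_system T} {FF : Filter F}
    (f h : T -> X) x y :
  f @ F --> x -> h @ F --> y ->
  half_sqdist (f t) (h t) @[t --> F] --> half_sqdist x y.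
Proof.
move=> fx hy; apply: cvgMr_tmp; rewrite expr2.
by under eq_fun do rewrite expr2; apply: cvgM; exact: cvg_mdist.
Qed.

(** The working form of an EVI flow: [phi] is the energy along [g], [k] is a nonnegative substitute
    for [-lambda], and the upper right derivative is unfolded into an inequality with error [e],
    valid just after [t]. *)
Context (E : X -> \bar R) (g : R -> X) (phi : R -> R) (k : R).
Context (k0 : 0 <= k).
Context (g_continuous : forall t : R, 0 < t -> g s @[s --> t] --> g t).
Context (phi_lsc : forall t : R, 0 < t -> forall e : R, 0 < e ->
  \forall s \near t, phi t - e < phi s).
Context (E_g : forall t : R, 0 < t -> E (g t) = (phi t)%:E).
Context (g_evi : forall x (v : R), E x = v%:E ->
  forall t : R, 0 < t -> forall e : R, 0 < e -> \forall s \near t^'+,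
  half_sqdist (g s) x <= half_sqdist (g t) x +
    (v - phi t + k * half_sqdist (g t) x + e) * (s - t)).

Lemma cvg_half_sqdist_left x (t : R) : 0 < t ->
  half_sqdist (g s) x @[s --> t^'-] --> half_sqdist (g t) x.
Proof.
move=> t0; apply: cvg_at_left_filter.
by apply: cvg_half_sqdist; [exact: g_continuous | exact: cvg_cst].
Qed.

(** If [phi a < phi b], let [s] be the last time in [[a, b]] with [phi s <= phi a]; it exists by
    lower semicontinuity. From [s] on, [phi] is at least [phi s], so EVI tested at [g s] and
    Gronwall's inequality keep the distance to [g s] at 0. Hence [g b = g s], a contradiction. *)
Lemma phi_nincr (a b : R) : 0 < a -> a <= b -> phi b <= phi a.
Proof.
move=> a0 ab; rewrite leNgt; apply/negP => phab.
pose S := [set t | a <= t <= b /\ phi t <= phi a].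
have Sa : S a by split; rewrite ?lexx ?ab.
have Sub : has_ubound S by exists b => t [/andP[]].
set s := sup S.
have as_ : a <= s by exact: ub_le_sup.
have sb : s <= b by apply: ge_sup; [exists a | move=> t [/andP[]]].
have s0 : 0 < s by lra.
have phs : phi s <= phi a.
  apply/ler_addgt0Pl => e e0.
  have [d /= d0 Hd] := phi_lsc s0 e0.
  have [|t [/andP[at_ tb] ft] dt] := @sup_adherent _ S d d0.
    by split => //; exists a.
  have ts : t <= s by apply: ub_le_sup => //; split=> //; rewrite at_ tb.
  have /Hd : `|s - t| < d by rewrite ger0_norm -/s in dt *; lra.
  by rewrite /=; lra.
have phgt t : s <= t <= b -> phi s <= phi t.
  move=> /andP[]; rewrite le_eqVlt => /predU1P[-> //|st tb].
  rewrite (le_trans phs) // leNgt; apply/negP => phta.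
  have : t <= s by apply: ub_le_sup => //; split; [rewrite tb; lra | exact: ltW].
  by lra.
suff : half_sqdist (g b) (g s) <= 0.
  move=> /half_sqdist_le0 gbs.
  have : E (g b) = E (g s) by rewrite gbs.
  by rewrite !E_g //; [move=> [?]; lra | lra].
have := @gronwall R (fun t => half_sqdist (g t) (g s)) (cst 0) s b k sb k0.
rewrite half_sqdistxx subrr addr0 mulr0; apply.
- by move=> t _; exact: half_sqdist_ge0.
- by move=> t /andP[st _]; apply: cvg_half_sqdist_left; lra.
- by move=> t _; exact: cvg_cst.
- by move=> *; rewrite lexx.
- move=> t /andP[st tb] e e0.
  have t0 : 0 < t by lra.
  have := g_evi (E_g s0) t0 e0; apply: filterS2 (nbhs_right_gt t) => r tr H.
  rewrite addr0; apply: (le_trans H); rewrite lerD2l ler_pM2r ?subr_gt0 // lerD2r.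
  by rewrite gerDr subr_le0; apply: phgt; rewrite st ltW.
Qed.

(** If [v < phi b], then [phi > v] on []0, b]]. EVI tested at [y] and Gronwall's inequality on
    [[a, b]] bound the distance from [g b] to [y] by one that vanishes as [a] tends to 0. So
    [g b = y], whose energy is [v]. *)
Lemma phi_le_start y (v b : R) : E y = v%:E ->
  mdist (g t) y @[t --> (0 : R)^'+] --> (0 : R) -> 0 < b -> phi b <= v.
Proof.
move=> Ey gy b0; rewrite leNgt; apply/negP => vb.
suff : half_sqdist (g b) y <= 0.
  move=> /half_sqdist_le0 gby.
  by move: (E_g b0); rewrite gby Ey => -[vE]; rewrite vE ltxx in vb.
have {Ey} y_evi := g_evi Ey.
have cv : expR (k * b) * half_sqdist (g a) y @[a --> (0 : R)^'+] --> (0 : R).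
  have z : 0 = expR (k * b) * (0 * 0 / 2) by rewrite !mul0r mulr0.
  rewrite [X in _ --> X]z.
  apply: cvgMl_tmp; apply: cvgMr_tmp.
  by under eq_fun do rewrite expr2; exact: cvgM.
apply: (cvgr_to_ge cv).
near=> a.
have a0 : 0 < a by near: a; exact: nbhs_right_gt.
have ab : a <= b by near: a; exact: nbhs_right_le.
have : half_sqdist (g b) y <= expR (k * (b - a)) * half_sqdist (g a) y.
  have := @gronwall R (fun t => half_sqdist (g t) y) (cst 0) a b k ab k0.
  rewrite subrr addr0; apply.
  - by move=> t _; exact: half_sqdist_ge0.
  - by move=> t /andP[st _]; apply: cvg_half_sqdist_left; lra.
  - by move=> t _; exact: cvg_cst.
  - by move=> *; rewrite lexx.
  - move=> t /andP[st tb] e e0.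
    have t0 : 0 < t by lra.
    have := y_evi t t0 e e0; apply: filterS2 (nbhs_right_gt t) => r tr H.
    rewrite addr0; apply: (le_trans H); rewrite lerD2l ler_pM2r ?subr_gt0 // lerD2r.
    by rewrite gerDr; have := phi_nincr t0 (ltW tb); lra.
move=> /le_trans; apply; apply: ler_wpM2r; first exact: half_sqdist_ge0.
by rewrite ler_expR ler_wpM2l //; lra.
Unshelve. all: by end_near. Qed.

(** Bounding the rate by a constant [C] reduces the integration of EVI to [le_of_dini]. *)
Lemma evi_integrated x (v a b C : R) : E x = v%:E -> 0 < a -> a <= b ->
  (forall t, a <= t < b -> v - phi t + k * half_sqdist (g t) x <= C) ->
  half_sqdist (g b) x <= half_sqdist (g a) x + C * (b - a).
Proof.
move=> /g_evi x_evi a0 ab HC.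
suff : half_sqdist (g b) x - C * b <= half_sqdist (g a) x - C * a by lra.
pose F t := half_sqdist (g t) x - C * t.
apply: (@le_of_dini R F) => //.
- move=> t /andP[at_ tb] e e0.
  have : F s @[s --> t^'-] --> F t.
    apply: cvgB; first by apply: cvg_half_sqdist_left; lra.
    by apply: cvgMl_tmp; apply: cvg_at_left_filter; exact: cvg_id.
  move=> /cvgrPdist_le /(_ _ e0); apply: filterS => s.
  by rewrite ler_distlC => /andP[]; rewrite lerBlDr.
- move=> t /[dup] tab /andP[at_ tb] e d e0 d0.
  have t0 : 0 < t by lra.
  have [r /= r0 Hr] := x_evi t t0 e e0.
  have m0 : 0 < Num.min (r / 2) (d / 2) by rewrite !lt_min !divr_gt0.
  set u := Num.min _ _ in m0.
  have ur : u <= r / 2 by rewrite /u !ge_min lexx.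
  have ud : u <= d / 2 by rewrite /u !ge_min lexx orbT.
  exists u; first by rewrite m0; lra.
  have /Hr : `|t - (t + u)| < r by rewrite opprD addNKr normrN gtr0_norm; lra.
  rewrite ltrDl => /(_ m0); rewrite (addrC t) addrK => fu.
  have : (v - phi t + k * half_sqdist (g t) x + e) * u <= (C + e) * u.
    by rewrite ler_pM2r // lerD2r HC.
  by rewrite /F; lra.
Qed.

(* The increment of the squared distance between [g] and its shift is bounded
   by applying the EVI to each curve in turn, the other one being frozen. *)
Lemma shift_contraction_sqr a b d : 0 < a -> a <= b -> 0 < d ->
  half_sqdist (g b) (g (b + d)) <=
    expR (2 * k * (b - a)) * half_sqdist (g a) (g (a + d)).
Proof.
move=> a0 ab d0.
pose w t := half_sqdist (g t) (g (t + d)).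
have shift_left t : (fun s : R => s + d) @ t --> t + d.
  by apply: cvgD; [exact: cvg_id | exact: cvg_cst].
have k20 : 0 <= 2 * k by rewrite mulr_ge0.
have := @gronwall R w (cst 0) a b (2 * k) ab k20.
rewrite subrr addr0; apply.
- by move=> t _; exact: half_sqdist_ge0.
- move=> t /andP[at_ _]; apply: cvg_at_left_filter; apply: cvg_half_sqdist.
    by apply: g_continuous; lra.
  by apply: (cvg_comp _ _ (shift_left t)); apply: g_continuous; lra.
- by move=> t _; exact: cvg_cst.
- by move=> *; rewrite lexx.
move=> t /andP[at_ tb] e e0.
have t0 : 0 < t by lra.
have td0 : 0 < t + d by lra.
have e40 : 0 < e / 4 by rewrite divr_gt0.
pose D := mdist (g t) (g (t + d)).
have D0 : 0 <= D by exact: mdist_ge0.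
(* Error budget: [e / 4] from EVI at [t], [e / 4] from semicontinuity of [phi] at [t + d], and
   [k * e2 <= e / 2] from the variation of the squared distance. The choice of [eta] gives [(D + 2 *
   eta) ^+ 2 / 2 <= D ^+ 2 / 2 + e2]. *)
have [e2 e20 e2E] : exists2 e2, 0 < e2 & e2 * (2 * (k + 1)) = e.
  have k1 : 0 < 2 * (k + 1) by lra.
  by exists (e / (2 * (k + 1))); rewrite ?divr_gt0 // divfK // gt_eqF.
have [eta [eta0 eta1 etaD]] :
    exists eta, [/\ 0 < eta, eta <= 1 & eta * (2 * D + 2) <= e2].
  exists (Num.min 1 (e2 / (2 * D + 2))); split.
  - by rewrite lt_min ltr01 /= divr_gt0 //; lra.
  - by rewrite ge_min lexx.
  - by rewrite -ler_pdivlMr ?ge_min ?lexx ?orbT //; lra.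
have evi1 := g_evi (E_g td0) t0 e40.
have [r1 /= r10 lsc1] := phi_lsc td0 e40.
have dist1 : \forall s \near t^'+, mdist (g t) (g s) <= eta.
  have gr : g s @[s --> t^'+] --> g t by apply: cvg_at_right_filter; exact: g_continuous.
  exact: (metricType_numDomainType.cvgr_dist_le gr).
have [r /= r0 Hr] : \forall s \near t + d, mdist (g (t + d)) (g s) <= eta.
  exact: (metricType_numDomainType.cvgr_dist_le (g_continuous td0)).
near=> s.
have ts : t < s by near: s; exact: nbhs_right_gt.
have sr : s - t < r by near: s; exact: nbhs_right_ltDr.
have evi1' : half_sqdist (g s) (g (t + d)) <= w t +
    (phi (t + d) - phi t + k * w t + e / 4) * (s - t).
  by near: s; exact: evi1.
have sr1 : s - t < r1 by near: s; exact: nbhs_right_ltDr.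
have {}lsc1 : phi (t + d) - e / 4 < phi (s + d).
  by apply: lsc1; rewrite /= ltr_distlC; apply/andP; split; lra.
have dist1' : mdist (g t) (g s) <= eta by near: s; exact: dist1.
(* The test point [g s] varies with [s], so EVI just after [t + d] would not be uniform in it; the
   integrated form on [[t + d, s + d]] is. *)
have evi2 : half_sqdist (g (s + d)) (g s) <= half_sqdist (g (t + d)) (g s) +
    (phi s - phi (s + d) + k * (w t + e2)) * (s + d - (t + d)).
  apply: (evi_integrated (E_g _)) => //; [lra | lra |].
  move=> u /andP[tu us].
  have h1 : phi (s + d) <= phi u by apply: phi_nincr; lra.
  have h2 : mdist (g (t + d)) (g u) <= eta.
    by apply: Hr; rewrite /= ltr_distlC; apply/andP; split; lra.
  have h3 : mdist (g u) (g s) <= D + 2 * eta.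
    have t1 := mdist_triangle (g u) (g (t + d)) (g s).
    have t2 := mdist_triangle (g (t + d)) (g t) (g s).
    rewrite (mdistC (g u) (g (t + d))) in t1; rewrite (mdistC (g (t + d)) (g t)) -/D in t2.
    by lra.
  have h4 : half_sqdist (g u) (g s) <= w t + e2.
    have sq : mdist (g u) (g s) ^+ 2 <= (D + 2 * eta) ^+ 2.
      by rewrite ler_sqr ?nnegrE ?mdist_ge0 // addr_ge0 // mulr_ge0 // ltW.
    have : eta * eta <= eta by rewrite ler_piMl // ltW.
    have -> : w t = D ^+ 2 / 2 by [].
    rewrite /half_sqdist; move: sq etaD; rewrite !expr2.
    by move: (mdist _ _) => M; lra.
  have : k * half_sqdist (g u) (g s) <= k * (w t + e2) by rewrite ler_wpM2l.
  by lra.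
have mono : phi s <= phi t by apply: phi_nincr => //; exact: ltW.
rewrite addr0 /= /w half_sqdistC -/(w t).
apply: (le_trans evi2); rewrite (half_sqdistC (g (t + d))).
apply: (le_trans (lerD evi1' (lexx _))).
rewrite -addrA lerD2l.
have -> : s + d - (t + d) = s - t by ring.
rewrite -mulrDl ler_pM2r ?subr_gt0 //.
by lra.
Unshelve. all: by end_near. Qed.

Lemma shift_contraction a b d : 0 < a -> a <= b -> 0 < d ->
  mdist (g b) (g (b + d)) <= expR (k * (b - a)) * mdist (g a) (g (a + d)).
Proof.
move=> a0 ab d0.
rewrite -ler_sqr ?nnegrE ?mdist_ge0 ?mulr_ge0 ?expR_ge0 ?mdist_ge0 //.
have := shift_contraction_sqr a0 ab d0.
rewrite exprMn -expRM_natl -mulrA mulr_natl => H.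
by move: H; rewrite /half_sqdist mulrA ler_pM2r ?invr_gt0.
Qed.

(** Each of the [N] links is a time shift of the first one, so [shift_contraction] controls it. *)
Lemma mdist_chain a h N : 0 < a -> 0 < h ->
  mdist (g a) (g (a + N%:R * h)) <=
    N%:R * (expR (k * (N%:R * h)) * mdist (g a) (g (a + h))).
Proof.
move=> a0 h0.
suff H n : (n <= N)%N -> mdist (g a) (g (a + n%:R * h)) <=
    n%:R * (expR (k * (N%:R * h)) * mdist (g a) (g (a + h))) by exact: H.
elim: n => [|n IH nN]; first by rewrite !mul0r addr0 mdistxx.
have nh0 : 0 <= n%:R * h by rewrite mulr_ge0 // ltW.
have aE : a + n.+1%:R * h = a + n%:R * h + h by rewrite -natr1; ring.
have t1 := mdist_triangle (g a) (g (a + n%:R * h)) (g (a + n.+1%:R * h)).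
apply: (le_trans t1).
rewrite [in leRHS]mulrS [in leRHS]mulrDl mul1r addrC.
apply: lerD; last by apply: IH; exact: ltnW.
rewrite aE; apply: (le_trans (shift_contraction a0 _ h0)); first by rewrite lerDl.
rewrite ler_wpM2r ?mdist_ge0 // ler_expR ler_wpM2l // (addrC a) addrK.
by rewrite ler_pM2r // ler_nat ltnW.
Qed.

(** The claim is that [phi] decreases on [[a, b]] at rate at least [A]. If it decreases more slowly
    just after some [t], EVI tested at [g t] makes [g] slow on [[t, t + h]]; contraction carries
    this to [b], and chaining [N] steps of length [h = H / N] contradicts the value of [D]. *)
Lemma phi_decrease a b H : 0 < a -> a < b -> 0 < H ->
  (b - a) * mdist (g b) (g (b + H)) ^+ 2 <=
    expR (k * (2 * (b - a) + 3 * H)) * H ^+ 2 * (phi a - phi b).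
Proof.
move=> a0 ab H0.
set D := mdist _ _; have D0 : 0 <= D by exact: mdist_ge0.
set K := expR _; have K0 : 0 < K by exact: expR_gt0.
pose A := (D / H) ^+ 2 / K.
have A0 : 0 <= A by rewrite divr_ge0 ?sqr_ge0 // ltW.
have DE : D ^+ 2 = A * K * H ^+ 2.
  by rewrite /A expr_div_n divfK ?gt_eqF // divfK // gt_eqF // exprn_gt0.
suff : A * (b - a) <= phi a - phi b.
  have KH0 : 0 < K * H ^+ 2 by rewrite mulr_gt0 // exprn_gt0.
  rewrite -(ler_pM2l KH0); apply: le_trans.
  by rewrite DE; lra.
suff : phi b + A * b <= phi a + A * a by lra.
apply: (@le_of_dini R (fun t => phi t + A * t)); first exact: ltW.
  move=> t /andP[at_ tb] e e0.
  near=> s.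
  have ts : s < t by near: s; exact: nbhs_left_lt.
  have as_ : a < s by near: s; exact: nbhs_left_gt.
  have h1 : phi t <= phi s by apply: phi_nincr; lra.
  have h2 : t - s < e / (A + 1).
    by near: s; apply: nbhs_left_ltBl; rewrite divr_gt0 //; lra.
  have : A * (t - s) <= (A + 1) * (t - s) by rewrite ler_wpM2r; lra.
  by rewrite ltr_pdivlMr in h2; lra.
move=> t /andP[at_ tb] e d e0 d0; apply: contrapT => Hno.
have t0 : 0 < t by lra.
have Hlt u : 0 < u < d -> phi t - phi (t + u) < (A - e) * u.
  move=> ud; rewrite ltNge; apply/negP => Hle; apply: Hno; exists u => //.
  by lra.
have Ae : 0 < A - e.
  have ud : 0 < d / 2 < d by lra.
  have := Hlt _ ud; have /andP[u0 _] := ud.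
  have : phi (t + d / 2) <= phi t by apply: phi_nincr => //; lra.
  move=> h1 h2; rewrite -(pmulr_lgt0 _ u0); lra.
(* [N] is so large that [h = H / N] is below [d], within the range of [Hlt]. *)
pose N := (Num.truncn (H / d)).+1.
have Nd : H / d < N%:R by rewrite /N truncnS_gt.
have N0 : 0 < N%:R :> R by rewrite ltr0n.
pose h := H / N%:R.
have h0 : 0 < h by rewrite divr_gt0.
have hd : h < d by rewrite /h ltr_pdivrMr // mulrC -ltr_pdivrMr.
have NhH : N%:R * h = H by rewrite /h mulrC divfK // gt_eqF.
have hH : h <= H by rewrite -NhH ler_peMl ?ler1n // ltW.
(* Primitive of [(A - e) * (s - t)], which bounds the energy lost since [t]. *)
pose beta s := (A - e) * ((s - t) ^+ 2 / 2).
have G : half_sqdist (g (t + h)) (g t) <= expR (k * h) * beta (t + h).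
  have th : t <= t + h by lra.
  have := @gronwall R (fun s => half_sqdist (g s) (g t)) beta t (t + h) k th k0.
  have bt : beta t = 0 by rewrite /beta subrr expr0n /= mul0r mulr0.
  have thE : t + h - t = h by ring.
  rewrite half_sqdistxx add0r bt subr0 thE; apply.
  - by move=> s _; exact: half_sqdist_ge0.
  - by move=> s /andP[ts _]; apply: cvg_half_sqdist_left; lra.
  - move=> s _; apply: cvg_at_left_filter.
    apply: cvgMl_tmp; apply: cvgMr_tmp; rewrite expr2.
    under eq_fun do rewrite expr2.
    by apply: cvgM; (apply: cvgB; [exact: cvg_id | exact: cvg_cst]).
  - move=> s r ts sr; rewrite /beta ler_pM2l // ler_pM2r ?invr_gt0 //.
    by rewrite ler_sqr ?nnegrE; lra.
  - move=> s /andP[ts sh] f f0.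
    have s0 : 0 < s by lra.
    have phs : phi t - phi s <= (A - e) * (s - t).
      have [<-|st] := eqVneq t s; first by rewrite !subrr mulr0.
      have /Hlt : 0 < s - t < d by rewrite subr_gt0 lt_neqAle st ts /=; lra.
      by rewrite (_ : t + (s - t) = s); [exact: ltW | ring].
    have := g_evi (E_g t0) s0 f0; apply: filterS2 (nbhs_right_gt s) => r sr.
    move=> /le_trans; apply.
    have bE : (A - e) * (s - t) * (r - s) <= beta r - beta s.
      rewrite /beta -mulrBr -mulrA ler_pM2l //.
      rewrite -subr_ge0.
      have -> : (r - t) ^+ 2 / 2 - (s - t) ^+ 2 / 2 - (s - t) * (r - s) =
        (r - s) ^+ 2 / 2 by field.
      by rewrite divr_ge0 ?sqr_ge0.
    have : (phi t - phi s) * (r - s) <= (A - e) * (s - t) * (r - s).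
      by rewrite ler_pM2r // subr_gt0.
    by lra.
have C1 : D <= N%:R * (expR (k * H) * mdist (g b) (g (b + h))).
  by have := mdist_chain N (lt_trans a0 ab) h0; rewrite NhH.
have C2 := shift_contraction t0 (ltW tb) h0.
have C3 : D <= N%:R * expR (k * (H + (b - a))) * mdist (g t) (g (t + h)).
  apply: (le_trans C1); rewrite mulrDr expRD -!mulrA ler_pM2l // ler_pM2l ?expR_gt0 //.
  apply: (le_trans C2); rewrite ler_wpM2r ?mdist_ge0 // ler_expR ler_wpM2l //.
  by lra.
have C4 : D ^+ 2 <= N%:R ^+ 2 * expR (k * (H + (b - a))) ^+ 2 * mdist (g t) (g (t + h)) ^+ 2.
  rewrite -!exprMn ler_sqr // ?nnegrE //.
  by rewrite !mulr_ge0 // ?expR_ge0 // mdist_ge0.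
have C5 : mdist (g t) (g (t + h)) ^+ 2 <= expR (k * H) * ((A - e) * h ^+ 2).
  rewrite mdistC.
  have : half_sqdist (g (t + h)) (g t) <= expR (k * H) * beta (t + h).
    apply: (le_trans G); rewrite ler_wpM2r //.
      by rewrite mulr_ge0 ?divr_ge0 ?sqr_ge0 // ltW.
    by rewrite ler_expR ler_wpM2l.
  by rewrite /half_sqdist /beta (addrC t) addrK !mulrA ler_pM2r ?invr_gt0.
have C6 : D ^+ 2 <= K * ((A - e) * H ^+ 2).
  have HE : H ^+ 2 = N%:R ^+ 2 * h ^+ 2 by rewrite -exprMn NhH.
  have KE : K = expR (k * (H + (b - a))) ^+ 2 * expR (k * H).
    by rewrite -expRM_natl -expRD /K; congr expR; ring.
  have q0 : 0 < N%:R ^+ 2 * expR (k * (H + (b - a))) ^+ 2.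
    by rewrite mulr_gt0 // exprn_gt0 // expR_gt0.
  rewrite -(ler_pM2l q0) in C5.
  by apply: (le_trans C4); apply: (le_trans C5); rewrite HE KE; lra.
move: C6; rewrite DE.
have : 0 < e * (K * H ^+ 2) by rewrite !mulr_gt0 // exprn_gt0.
by lra.
Unshelve. all: by end_near. Qed.

(** The increment over [[s, t]] is shifted back to start at [b] by contraction, then [phi_decrease]
    pays for it with the energy lost on [[a, b]]. *)
Lemma flow_lipschitz_sqr a b h s t : 0 < a -> a < b -> b <= s -> s <= t ->
  t <= b + h ->
  (b - a) * mdist (g s) (g t) ^+ 2 <=
    expR (k * (2 * (b - a) + 5 * h)) * (t - s) ^+ 2 * (phi a - phi b).
Proof.
move=> a0 ab bs; rewrite le_eqVlt => /predU1P[<- _|st tbh].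
  by rewrite mdistxx subrr expr0n /= !mulr0 mul0r.
have st0 : 0 < t - s by rewrite subr_gt0.
have b0 : 0 < b by lra.
have C1 := shift_contraction b0 bs st0.
rewrite (_ : s + (t - s) = t) in C1; last by ring.
set M := mdist _ (g t) in C1 *; set N := mdist _ _ in C1.
have M0 : 0 <= M by exact: mdist_ge0.
have C2 : M ^+ 2 <= expR (k * (s - b)) ^+ 2 * N ^+ 2.
  by rewrite -exprMn ler_sqr // nnegrE mulr_ge0 ?expR_ge0 // mdist_ge0.
have C3 := phi_decrease a0 ab st0.
rewrite -/N in C3.
have dphi : 0 <= phi a - phi b by rewrite subr_ge0; apply: phi_nincr => //; exact: ltW.
have e0 : 0 < expR (k * (s - b)) ^+ 2 by rewrite exprn_gt0 // expR_gt0.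
apply: (@le_trans _ _ (expR (k * (s - b)) ^+ 2 * ((b - a) * N ^+ 2))).
  by rewrite [leRHS]mulrCA ler_pM2l // subr_gt0.
rewrite -(ler_pM2l e0) in C3; apply: (le_trans C3).
have key : expR (k * (s - b)) ^+ 2 * expR (k * (2 * (b - a) + 3 * (t - s))) <=
    expR (k * (2 * (b - a) + 5 * h)).
  rewrite -expRM_natl -expRD ler_expR.
  have -> : 2%:R * (k * (s - b)) + k * (2 * (b - a) + 3 * (t - s)) =
    k * (2 * (s - b) + (2 * (b - a) + 3 * (t - s))) by ring.
  by rewrite ler_wpM2l //; lra.
have p0 : 0 <= (t - s) ^+ 2 * (phi a - phi b) by rewrite mulr_ge0 ?sqr_ge0.
by have := ler_wpM2r p0 key; lra.
Qed.

(** [flow_lipschitz_sqr] with [a := b - h], made linear by [2 * theta * M * (t - s) <= theta ^+ 2 *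
    (t - s) ^+ 2 + M ^+ 2]. *)
Lemma flow_lipschitz theta b h s t : 0 < theta -> 0 < h -> h < b ->
  b <= s -> s <= t -> t <= b + h ->
  mdist (g s) (g t) <=
    (theta + expR (k * (7 * h)) / theta * ((phi (b - h) - phi b) / h)) / 2 * (t - s).
Proof.
move=> th0 h0 hb bs st tbh.
set L := _ / 2; set M := mdist _ _.
have bh0 : 0 < b - h by lra.
have bhb : b - h < b by lra.
have := flow_lipschitz_sqr bh0 bhb bs st tbh.
rewrite -/M (_ : b - (b - h) = h); last by ring.
rewrite (_ : 2 * h + 5 * h = 7 * h); last by ring.
move=> HM.
have [st'|] := ltP s t; last first.
  move=> ts; have tE : t = s by apply/eqP; rewrite eq_le st ts.
  by rewrite /M tE mdistxx subrr mulr0.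
have d0 : 0 < t - s by rewrite subr_gt0.
have LE : 2 * theta * h * L = h * theta ^+ 2 + expR (k * (7 * h)) * (phi (b - h) - phi b).
  by rewrite /L; field; rewrite !gt_eqF.
have p0 : 0 < 2 * theta * h * (t - s) by rewrite !mulr_gt0.
rewrite -(ler_pM2l p0).
have -> : 2 * theta * h * (t - s) * (L * (t - s)) = 2 * theta * h * L * (t - s) ^+ 2.
  by ring.
rewrite LE.
have : 0 <= h * (M - theta * (t - s)) ^+ 2 by rewrite mulr_ge0 ?sqr_ge0 // ltW.
by move: HM; rewrite !expr2; lra.
Qed.

(** As at most [v - c] of energy is lost on [[t / 2, t]], the speed of [g] is of order [1 / sqrt t],
    which the substitution [t = r ^+ 2] makes bounded. *)
Lemma quadratic_reparam_lipschitz c v : (forall t, 0 < t -> c <= phi t <= v) ->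
  exists2 L, 0 <= L & forall r q, 0 < r -> r <= q -> q <= 1 ->
    mdist (g (r ^+ 2)) (g (q ^+ 2)) <= L * (q - r).
Proof.
move=> phicv.
have cv : c <= v by have /andP[/le_trans] := phicv 1 ltr01; apply.
pose Q := 18 * expR (k * 6) * (v - c).
have Q0 : 0 <= Q by rewrite !mulr_ge0 ?expR_ge0 // subr_ge0.
pose L := Num.sqrt Q.
have L0 : 0 <= L by exact: sqrtr_ge0.
(* For [q <= 2 * r], [(q + r) ^+ 2 <= 9 * r ^+ 2]; dividing by the waiting time [r ^+ 2 / 2] gives
   the constant 18. The restriction on [q] is lifted by [le_of_dini]. *)
have local r q : 0 < r -> r <= q -> q <= 2 * r -> q <= 1 ->
    mdist (g (r ^+ 2)) (g (q ^+ 2)) <= L * (q - r).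
  move=> r0 rq q2r q1.
  rewrite -ler_sqr ?nnegrE ?mdist_ge0 ?mulr_ge0 ?subr_ge0 // exprMn sqr_sqrtr //.
  have r20 : 0 < r ^+ 2 by rewrite exprn_gt0.
  have r1 : r ^+ 2 <= 1 by rewrite expr_le1 //; lra.
  have q1' : q ^+ 2 <= 1 by rewrite expr_le1 //; lra.
  have rq2 : r ^+ 2 <= q ^+ 2 by rewrite ler_sqr ?nnegrE; lra.
  have a0 : 0 < r ^+ 2 / 2 by lra.
  have ab : r ^+ 2 / 2 < r ^+ 2 by lra.
  have tb : q ^+ 2 <= r ^+ 2 + (q ^+ 2 - r ^+ 2) by lra.
  have := flow_lipschitz_sqr a0 ab (lexx _) rq2 tb.
  have /andP[_ h1] := phicv _ a0; have /andP[h2 _] := phicv _ r20.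
  have h3 := phi_nincr a0 (ltW ab).
  set M := mdist _ _; set C := expR _; move=> HM.
  have CE : C <= expR (k * 6) by rewrite ler_expR ler_wpM2l //; lra.
  have sq : (q ^+ 2 - r ^+ 2) ^+ 2 <= (q - r) ^+ 2 * (9 * r ^+ 2).
    rewrite subr_sqr exprMn ler_wpM2l ?sqr_ge0 //.
    rewrite (_ : 9 * r ^+ 2 = (3 * r) ^+ 2); last by ring.
    by rewrite ler_sqr ?nnegrE; lra.
  have : C * (q ^+ 2 - r ^+ 2) ^+ 2 * (phi (r ^+ 2 / 2) - phi (r ^+ 2)) <=
      expR (k * 6) * ((q - r) ^+ 2 * (9 * r ^+ 2)) * (v - c).
    apply: ler_pM => //; [|by lra| |by lra].
      by rewrite mulr_ge0 ?sqr_ge0 // expR_ge0.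
    by apply: ler_pM => //; [exact: expR_ge0 | exact: sqr_ge0].
  move=> /(le_trans HM).
  have -> : r ^+ 2 - r ^+ 2 / 2 = r ^+ 2 / 2 by field.
  have -> : expR (k * 6) * ((q - r) ^+ 2 * (9 * r ^+ 2)) * (v - c) =
     r ^+ 2 / 2 * (Q * (q - r) ^+ 2) by rewrite /Q; field.
  by rewrite ler_pM2l.
exists L => // r q r0 rq q1.
suff : mdist (g (r ^+ 2)) (g (q ^+ 2)) - L * q <= mdist (g (r ^+ 2)) (g (r ^+ 2)) - L * r.
  by rewrite mdistxx; lra.
pose F q := mdist (g (r ^+ 2)) (g (q ^+ 2)) - L * q.
apply: (@le_of_dini R F) => //.
- move=> t /andP[at_ tb] e e0.
  have : F s @[s --> t^'-] --> F t.
    apply: cvg_at_left_filter; apply: cvgB; last by apply: cvgMl_tmp; exact: cvg_id.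
    apply: cvg_mdist; first exact: cvg_cst.
    apply: (cvg_comp (fun s : R => s ^+ 2) g); first exact: exprn_continuous.
    by apply: g_continuous; rewrite exprn_gt0 //; lra.
  move=> /cvgrPdist_le /(_ _ e0); apply: filterS => s.
  by rewrite ler_distlC => /andP[]; rewrite lerBlDr.
- move=> t /andP[at_ tb] e d e0 d0.
  have m0 : 0 < Num.min (t / 2) (Num.min (d / 2) (q - t)).
    by rewrite !lt_min subr_gt0 tb; apply/and3P; split=> //; lra.
  set u := Num.min _ _ in m0.
  have ut : u <= t / 2 by rewrite /u !ge_min lexx.
  have ud : u <= d / 2 by rewrite /u !ge_min lexx orbT.
  have uq : u <= q - t by rewrite /u !ge_min lexx !orbT.
  exists u; first by rewrite m0; lra.
  have H : mdist (g (t ^+ 2)) (g ((t + u) ^+ 2)) <= L * (t + u - t).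
    by apply: local; lra.
  have t1 := mdist_triangle (g (r ^+ 2)) (g (t ^+ 2)) (g ((t + u) ^+ 2)).
  have eu : 0 < e * u by rewrite mulr_gt0.
  by rewrite /F; lra.
Qed.

(** * Length distance along the flow *)

Context {Y : set X} {y : X} {v c : R}.
Context (Y_metric : metric_on Y (length_dist Y)).
Context (Yy : Y y) (Yg : forall t : R, 0 < t -> Y (g t)).
Context (g_start : mdist (g t) y @[t --> (0 : R)^'+] --> (0 : R)).
Context (phi_bounds : forall t : R, 0 < t -> c <= phi t <= v).

Let dY x x' := fine (length_dist Y x x').

Let dYE x x' : Y x -> Y x' -> length_dist Y x x' = (dY x x')%:E.
Proof.
case: Y_metric => h _ _ _ Yx Yx'; have /andP[h0 h1] := h _ _ Yx Yx'.
by rewrite fineK // ge0_fin_numE.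
Qed.

Let dY_triangle x x' x'' : Y x -> Y x' -> Y x'' -> dY x x'' <= dY x x' + dY x' x''.
Proof.
move=> Yx Yx' Yx''; rewrite -lee_fin EFinD -!dYE //.
by case: Y_metric => _ _ _; apply.
Qed.

(** Covers the initial time interval, where no earlier energy loss is available to bound the speed:
    the reparametrized flow, completed by [y] at 0, is a Lipschitz curve in [Y]. *)
Lemma length_dist_start : exists2 L, 0 <= L &
  forall q : R, 0 < q <= 1 -> dY y (g (q ^+ 2)) <= L * q.
Proof.
have [L L0 HL] := quadratic_reparam_lipschitz phi_bounds.
exists L => // q /andP[q0 q1].
pose cu (r : R) := if r <= 0 then y else g (r ^+ 2).
have sq0 (r : R) : 0 < r -> 0 < r ^+ 2 by move=> r0; rewrite exprn_gt0.
have Hy r : 0 < r -> r <= 1 -> mdist y (g (r ^+ 2)) <= L * r.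
  move=> r0 r1; apply/ler_addgt0Pr => e e0.
  have [d /= d0 Hd] := (cvgrPdist_le _ _).1 g_start _ e0.
  pose s := Num.min (r / 2) (Num.min (1 / 2) (d / 2)).
  have s0 : 0 < s by rewrite !lt_min !divr_gt0.
  have sr : s <= r / 2 by rewrite /s ge_min lexx.
  have s1 : s <= 1 / 2 by rewrite /s !ge_min lexx orbT.
  have sd : s <= d / 2 by rewrite /s !ge_min lexx !orbT.
  have ss : s ^+ 2 <= s by rewrite expr2 ler_piMl //; lra.
  have h1 : mdist (g (s ^+ 2)) y <= e.
    have := Hd (s ^+ 2); rewrite /= !sub0r !normrN !ger0_norm ?mdist_ge0 ?sqr_ge0 //.
    by apply; [lra | exact: sq0].
  have h2 : mdist (g (s ^+ 2)) (g (r ^+ 2)) <= L * (r - s) by apply: HL; lra.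
  have h3 := mdist_triangle y (g (s ^+ 2)) (g (r ^+ 2)).
  rewrite (mdistC y (g (s ^+ 2))) in h3.
  have : 0 <= L * s by rewrite mulr_ge0 // ltW.
  by lra.
have := @length_dist_le_lipschitz_itv R X Y cu L 0 q (ltW q0).
have cu0 : cu 0 = y by rewrite /cu lexx.
have cuq : cu q = g (q ^+ 2) by rewrite /cu leNgt q0.
rewrite cu0 cuq dYE //; last exact: Yg (sq0 _ q0).
rewrite lee_fin subr0; apply.
- move=> t _; rewrite /cu; have [//|t0] := leP t 0.
  by apply: Yg; exact: sq0.
- move=> r s r0 rs sq; rewrite /cu.
  have [r0'|r0'] := leP r 0.
    have -> : r = 0 by apply/eqP; rewrite eq_le r0 r0'.
    have [s0|s0] := leP s 0; last by rewrite subr0; apply: Hy; lra.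
    by rewrite mdistxx mulr_ge0 // subr_ge0; lra.
  by rewrite (leNgt s) (lt_le_trans r0' rs) /=; apply: HL; lra.
Qed.

Lemma length_dist_step theta b h : 0 < theta -> 0 < h -> h < b ->
  dY (g b) (g (b + h)) <=
    (theta * h + expR (k * (7 * h)) / theta * (phi (b - h) - phi b)) / 2.
Proof.
move=> th0 h0 hb.
pose L := (theta + expR (k * (7 * h)) / theta * ((phi (b - h) - phi b) / h)) / 2.
have b0 : 0 < b by lra.
have bb : b <= b + h by lra.
have := @length_dist_le_lipschitz_itv R X Y g L b (b + h) bb.
rewrite dYE; [|exact: Yg|by apply: Yg; lra].
rewrite lee_fin => H; apply: (le_trans (H _ _)).
- by move=> t /andP[bt _]; apply: Yg; lra.
- by move=> r q br rq qb; apply: flow_lipschitz.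
- rewrite (_ : b + h - b = h); last by ring.
  by rewrite /L le_eqVlt; apply/orP; left; apply/eqP; field; rewrite !gt_eqF.
Qed.

(** Each step is paid for by the energy lost on the preceding one. The chain therefore starts at
    [2 * h], and the telescoped loss begins at [h] and ends one step early. *)
Lemma length_dist_chain theta h n : 0 < theta -> 0 < h ->
  dY (g (2 * h)) (g (2 * h + n%:R * h)) <=
    (theta * (n%:R * h) +
     expR (k * (7 * h)) / theta * (phi h - phi (h + n%:R * h))) / 2.
Proof.
move=> th0 h0; have h20 : 0 < 2 * h by lra.
elim: n => [|n IH].
  rewrite !mul0r !addr0 !subrr !mulr0 addr0 mul0r.
  case: Y_metric => _ /(_ (g (2 * h)) (g (2 * h)) (Yg h20) (Yg h20))[_ /(_ erefl) + ] _ _.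
  by rewrite dYE; [case=> -> | exact: Yg | exact: Yg].
have nh0 : 0 <= n%:R * h by rewrite mulr_ge0 // ltW.
have E1 : 2 * h + n.+1%:R * h = 2 * h + n%:R * h + h by rewrite -natr1; ring.
have E2 : h + n.+1%:R * h = 2 * h + n%:R * h by rewrite -natr1; ring.
have E3 : n.+1%:R * h = n%:R * h + h by rewrite -natr1; ring.
have hb : h < 2 * h + n%:R * h by lra.
have S := length_dist_step th0 h0 hb.
have E4 : 2 * h + n%:R * h - h = h + n%:R * h by ring.
rewrite E4 in S; rewrite E1 E2 E3.
have Y1 : Y (g (2 * h + n%:R * h)) by apply: Yg; lra.
have Y2 : Y (g (2 * h + n%:R * h + h)) by apply: Yg; lra.
apply: (le_trans (dY_triangle (Yg h20) Y1 Y2)).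
by move: IH S; move: (expR _ / theta) => C; lra.
Qed.

Lemma length_dist_flow theta t : 0 < theta -> 0 < t ->
  dY y (g t) <= (theta * t + (v - phi t) / theta) / 2.
Proof.
move=> th0 t0.
have [L L0 HL] := length_dist_start.
have a0 : 0 <= v - phi t by rewrite subr_ge0; have /andP[] := phi_bounds t0.
pose B h := L * Num.sqrt (2 * h) +
  (theta * t + expR (k * (7 * h)) / theta * (v - phi t)) / 2.
have cB : B h @[h --> (0 : R)^'+] --> B 0.
  apply: cvg_at_right_filter; apply: cvgD.
    apply: cvgMl_tmp; apply: (cvg_comp (fun h : R => 2 * h) Num.sqrt).
      by apply: cvgMl_tmp; exact: cvg_id.
    exact: sqrt_continuous.
  apply: cvgMr_tmp; apply: cvgD; first exact: cvg_cst.
  apply: cvgMr_tmp; apply: cvgMr_tmp.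
  apply: (cvg_comp (fun h : R => k * (7 * h)) expR).
    by apply: cvgMl_tmp; apply: cvgMl_tmp; exact: cvg_id.
  exact: continuous_expR.
have B0 : B 0 = (theta * t + (v - phi t) / theta) / 2.
  by rewrite /B !mulr0 sqrtr0 mulr0 add0r expR0 mul1r (mulrC _^-1).
rewrite -B0; apply/ler_addgt0Pr => e e0.
have [d /= d0 Hd] := (cvgrPdist_le _ _).1 cB _ e0.
(* The mesh is [h = t / (N + 2)]: two steps for the initial interval, handled by
   [length_dist_start], and [N] for the chain. The bound [h < 1 / 2] ensures
   [Num.sqrt (2 * h) <= 1]. *)
pose N := (Num.truncn (t / Num.min d (1 / 2))).+1.
have m0 : 0 < Num.min d (1 / 2) by rewrite lt_min d0 divr_gt0.
have Nt : t / Num.min d (1 / 2) < N%:R by exact: truncnS_gt.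
pose h := t / N.+2%:R.
have h0 : 0 < h by rewrite divr_gt0.
have htE : N.+2%:R * h = t by rewrite /h mulrC divfK // pnatr_eq0.
have hN : N%:R * h = t - 2 * h by rewrite -htE -(natr1 N.+1) -(natr1 N); ring.
have Nh0 : 0 <= N%:R * h by rewrite mulr_ge0 // ltW.
have hm : h < Num.min d (1 / 2).
  rewrite /h ltr_pdivrMr // mulrC -ltr_pdivrMr //; apply: (lt_le_trans Nt).
  by rewrite ler_nat (leq_trans (leqnSn N)).
move: hm; rewrite lt_min => /andP[hd h1].
have hB : B h <= B 0 + e.
  have := Hd h; rewrite /= sub0r normrN gtr0_norm // => /(_ hd h0).
  by rewrite ler_distlC => /andP[_]; lra.
apply: le_trans hB.
have t2h : 2 * h + N%:R * h = t by rewrite hN; ring.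
have h20 : 0 < 2 * h by lra.
apply: (le_trans (dY_triangle Yy (Yg h20) (Yg t0))); apply: lerD.
  have q01 : 0 < Num.sqrt (2 * h) <= 1.
    by rewrite sqrtr_gt0 h20 /= -[leRHS]sqrtr1 ler_sqrt //; lra.
  by have := HL _ q01; rewrite sqr_sqrtr // ltW.
have := length_dist_chain N th0 h0; rewrite t2h => /le_trans; apply.
rewrite ler_pM2r ?invr_gt0 //; apply: lerD.
  by rewrite ler_pM2l // hN; lra.
rewrite ler_wpM2l ?divr_ge0 ?expR_ge0 ?(ltW th0) //.
have /andP[_ hv] := phi_bounds h0.
have ht : phi t <= phi (h + N%:R * h).
  by apply: phi_nincr; lra.
by lra.
Qed.

(* With [theta := K], the a priori bound [v - phi t <= K * dY y (g t)] absorbs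
   the last term of [length_dist_flow], whence [dY y (g t) <= K * t]. *)
Lemma descent_of_length_descent K e x u : 0 < K -> 0 < e ->
  (forall x x', Y x -> Y x' -> mdist x x' <= dY x x') ->
  (forall x' u, Y x' -> E x' = u%:E -> dY y x' < e -> v - u <= K * dY y x') ->
  E x = u%:E -> v - u <= K * mdist y x + k * half_sqdist y x.
Proof.
move=> K0 e0 ddY Hslope Ex.
have vc : c <= v by have /andP[/le_trans] := phi_bounds (@ltr01 R); apply.
(* With this parameter [length_dist_flow] gives [dY y (g t) < e] for [t < tau], so the descent
   hypothesis applies to [g t]. *)
pose th := (v - c + 1) / e.
have th0 : 0 < th by rewrite divr_gt0 //; lra.
pose tau := Num.min (e / (2 * th)) (1 / 2).
have tau0 : 0 < tau by rewrite lt_min !divr_gt0 // mulr_gt0.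
have small t : 0 < t -> t < tau -> mdist y (g t) <= K * t /\ v - phi t <= K ^+ 2 * t.
  move=> t0; rewrite lt_min => /andP[tth t1].
  have /andP[cphi phiv] := phi_bounds t0.
  have De : dY y (g t) < e.
    apply: (le_lt_trans (length_dist_flow th0 t0)).
    have h1 : th * t < e / 2.
      by move: tth; rewrite invfM mulrA ltr_pdivlMr // mulrC.
    have h2 : (v - phi t) / th < e.
      by rewrite ltr_pdivrMr // /th mulrC divfK ?gt_eqF //; lra.
    by lra.
  have A := Hslope _ _ (Yg t0) (E_g t0) De.
  have D := length_dist_flow K0 t0.
  have DK : dY y (g t) <= K * t.
    suff : (v - phi t) / K <= dY y (g t) by lra.
    by rewrite ler_pdivrMr // mulrC.
  split; first exact: le_trans (ddY _ _ Yy (Yg t0)) DK.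
  apply: (le_trans A); rewrite expr2 -mulrA ler_pM2l //.
set D := mdist y x; have D0 : 0 <= D by exact: mdist_ge0.
pose C0 := u - v + k * (D ^+ 2 / 2).
pose B := D * K + 2 * K ^+ 2 + k * (D * K + K ^+ 2) + `|C0|.
have B0 : 0 <= B.
  by rewrite !addr_ge0 ?mulr_ge0 ?addr_ge0 ?mulr_ge0 ?sqr_ge0 ?(ltW K0).
(* EVI is integrated over [[t ^+ 2, t]]: the left end stays positive, yet [g (t ^+ 2)] is within
   [K * t ^+ 2] of [y], negligible after division by [t]. [B] collects all remaining terms of order
   [t]. *)
have key t : 0 < t -> t < tau -> - (K * D) <= C0 + B * t.
  move=> t0 ttau.
  have t1 : t < 1 by move: ttau; rewrite lt_min => /andP[_]; lra.
  have tt : t ^+ 2 < t by rewrite expr2 -[ltRHS]mul1r ltr_pM2r.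
  have tt0 : 0 < t ^+ 2 by rewrite exprn_gt0.
  pose C := u - v + K ^+ 2 * t + k * ((D + K * t) ^+ 2 / 2).
  have Kt0 : 0 < K * t by rewrite mulr_gt0.
  have [gt _] := small _ t0 ttau.
  have [gtt _] := small _ tt0 (lt_trans tt ttau).
  have I : half_sqdist (g t) x <= half_sqdist (g (t ^+ 2)) x + C * (t - t ^+ 2).
    apply: (evi_integrated Ex) => //; first exact: ltW.
    move=> r /andP[tr rt].
    have r0 : 0 < r by lra.
    have [gr phr] := small _ r0 (lt_trans rt ttau).
    have h1 : mdist (g r) x <= D + K * t.
      have t3 := mdist_triangle (g r) y x; rewrite (mdistC (g r) y) -/D in t3.
      have : K * r <= K * t by rewrite ler_pM2l // ltW.
      by lra.
    have h2 : half_sqdist (g r) x <= (D + K * t) ^+ 2 / 2.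
      by rewrite ler_pM2r ?invr_gt0 // ler_sqr ?nnegrE ?mdist_ge0 // addr_ge0 // ltW.
    have h3 : k * half_sqdist (g r) x <= k * ((D + K * t) ^+ 2 / 2) by rewrite ler_wpM2l.
    have : K ^+ 2 * r <= K ^+ 2 * t by rewrite ler_pM2l ?exprn_gt0 // ltW.
    by rewrite /C; lra.
  have lower : D ^+ 2 / 2 - D * (K * t) <= half_sqdist (g t) x.
    have t3 := mdist_triangle y (g t) x; rewrite -/D in t3.
    rewrite /half_sqdist; have := mdist_ge0 (g t) x.
    move: (mdist (g t) x) t3 => M t3 M0.
    have [h|h] := leP D (K * t).
      have : D * D <= D * (K * t) by rewrite ler_wpM2l.
      have : 0 <= D * D by rewrite mulr_ge0.
      have : 0 <= M ^+ 2 by exact: sqr_ge0.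
      by rewrite !expr2; lra.
    have : (D - K * t) ^+ 2 <= M ^+ 2 by rewrite ler_sqr ?nnegrE //; lra.
    have : 0 <= (K * t) ^+ 2 by exact: sqr_ge0.
    by rewrite !expr2; lra.
  have upper : half_sqdist (g (t ^+ 2)) x <= D ^+ 2 / 2 + D * (K * t ^+ 2) + (K * t ^+ 2) ^+ 2 / 2.
    have t3 := mdist_triangle (g (t ^+ 2)) y x.
    rewrite (mdistC (g (t ^+ 2)) y) -/D in t3.
    rewrite /half_sqdist; have := mdist_ge0 (g (t ^+ 2)) x.
    move: (mdist (g (t ^+ 2)) x) t3 => M t3 M0.
    have p0 : 0 <= K * t ^+ 2 by rewrite mulr_ge0 ?ltW.
    have : M ^+ 2 <= (D + K * t ^+ 2) ^+ 2 by rewrite ler_sqr ?nnegrE ?addr_ge0 //; lra.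
    by rewrite !expr2; lra.
  rewrite -(ler_pM2r t0).
  have H : - (D * (K * t)) <= D * (K * t ^+ 2) + (K * t ^+ 2) ^+ 2 / 2 + C * (t - t ^+ 2).
    by lra.
  have CE : C = C0 + K ^+ 2 * t + k * (D * K * t) + k * (K ^+ 2 * t ^+ 2) / 2.
    by rewrite /C /C0; field.
  have n0 : - C0 * t ^+ 2 <= `|C0| * t ^+ 2 by rewrite ler_pM2r // -normrN ler_norm.
  have K20 : 0 <= K ^+ 2 by exact: sqr_ge0.
  have t0' := ltW t0.
  have t4 : K ^+ 2 * t ^+ 4 <= K ^+ 2 * t ^+ 2.
    by rewrite ler_wpM2l // ler_wiXn2l // ltW.
  have t3 : (k * K ^+ 2) * t ^+ 3 <= (k * K ^+ 2) * t ^+ 2.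
    by apply: ler_wpM2l; [exact: mulr_ge0 | rewrite ler_wiXn2l // ltW].
  have p1 : 0 <= K ^+ 2 * t ^+ 3 by rewrite mulr_ge0 // exprn_ge0.
  have p2 : 0 <= k * (D * K) * t ^+ 3.
    apply: mulr_ge0; last exact: exprn_ge0.
    by apply: mulr_ge0 => //; apply: mulr_ge0 => //; exact: ltW.
  have p3 : 0 <= k * K ^+ 2 * t ^+ 4 by apply: mulr_ge0; [exact: mulr_ge0 | exact: exprn_ge0].
  have p4 : 0 <= K ^+ 2 * t ^+ 2 by rewrite mulr_ge0 // exprn_ge0.
  have p5 : 0 <= k * K ^+ 2 * t ^+ 2.
    by apply: mulr_ge0; [exact: mulr_ge0 | exact: exprn_ge0].
  by move: H; rewrite CE /B; lra.
rewrite -/D /half_sqdist -/D.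
suff : - (K * D) <= C0 by rewrite /C0; lra.
apply/ler_addgt0Pr => f f0.
pose t := Num.min (tau / 2) (f / (B + 1)).
have t0 : 0 < t by rewrite lt_min !divr_gt0 //; lra.
have ttau : t < tau by rewrite gt_min; apply/orP; left; lra.
apply: (le_trans (key _ t0 ttau)); rewrite lerD2l.
have : (B + 1) * t <= f by rewrite mulrC -ler_pdivlMr ?ge_min ?lexx ?orbT //; lra.
by lra.
Qed.

End evi_path.

(** * Continuity, local EVI and energy semicontinuity of flows *)

Section EVI_flow_theory.
Context {R : realType} {X : metricType R}.
Local Open Scope ring_scope.
Local Notation mu := (@lebesgue_measure R).
Implicit Types (E : X -> \bar R) (gamma : R -> X).

Lemma AC2loc_continuous gamma (t : R) : AC2loc gamma -> 0 < t ->
  gamma s @[s --> t] --> gamma t.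
Proof.
move=> gAC t0; pose a := t / 2; pose b := t + 1 / 2.
have a0 : 0 < a by rewrite divr_gt0.
have at_ : a < t by rewrite /a; lra.
have tb : t < b by rewrite /b; lra.
have [|||m mL gm] := gAC `]0, (t + 1)[%classic.
- exact: interval_is_interval.
- exists (t + 1); split; first exact: num_real.
  move=> B tB x; rewrite /= in_itv /= => /andP[x0 xt].
  by rewrite gtr0_norm // ltW // (lt_trans xt).
- by move=> x /=; rewrite !in_itv /= => /andP[->].
pose m0 : R -> R := m \_ `]0, (t + 1)[.
(* Square integrability suffices on a bounded interval, by [|m0| <= 1 + m0 ^+ 2]. *)
have im0 : mu.-integrable `[a, b] (EFin \o m0).
  have i2 : mu.-integrable `[a, b] (EFin \o (fun x => m0 x ^+ 2)).
    by apply: integrableS (Lfun2_integrable_sqr mL).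
  have i1 : mu.-integrable `[a, b] (EFin \o cst 1).
    apply/integrableP; split; first exact/measurable_EFinP/measurable_cst.
    rewrite /= integral_cst //= lebesgue_measure_itv /= lte_fin (lt_trans at_ tb).
    by rewrite -EFinD -EFinM ltry.
  apply: le_integrable (integrableD _ i1 i2) => //.
    apply/measurable_EFinP; apply: measurable_funTS.
    by move: mL; rewrite inE => /andP[/[!inE]].
  move=> x _; rewrite /= lee_fin [leRHS]ger0_norm; last first.
    by rewrite addr_ge0 // sqr_ge0.
  have : 0 <= (`|m0 x| - 1) ^+ 2 by exact: sqr_ge0.
  rewrite sqrrB1 real_normK ?num_real //.
  by have := sqr_ge0 (m0 x); lra.
have ab : a < b by lra.
pose M (x : R) : R := \int[mu]_(u in `[a, x]) m0 u.
have gM s r : a <= s -> s <= r -> r <= b -> mdist (gamma s) (gamma r) <= M r - M s.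
  move=> as_; rewrite le_eqVlt => /predU1P[<- _|sr rb].
    by rewrite mdistxx subrr.
  have is_ : mu.-integrable `[a, r] (EFin \o m0).
    by apply: integrableS im0 => //; apply: subset_itvl; rewrite bnd_simp.
  have -> : M r - M s = \int[mu]_(u in `]s, r]) m0 u.
    by apply: Rintegral_itvB => //; rewrite bnd_simp // ltW.
  rewrite Rintegral_itv_obnd_cbnd; last first.
    by apply: integrableS is_ => //; apply: subset_itvr; rewrite bnd_simp.
  rewrite (@eq_Rintegral _ _ _ mu _ m) => [|u]; last first.
    rewrite inE /= in_itv /= => /andP[su ur].
    by rewrite /m0 patchE mem_set //= in_itv /=; rewrite /b in rb; apply/andP; split; lra.
  by apply: gm; rewrite //= in_itv /=; rewrite /b in rb; apply/andP; split; lra.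
have cM : {for t, continuous M}.
  have := parameterized_integral_continuous (ltW ab) im0.
  by move=> /(continuous_within_itvP _ ab)[cM' _ _]; apply: cM'; rewrite in_itv /= at_.
apply/metricType_numDomainType.cvgrPdist_lt => e e0.
have [d /= d0 Hd] := (cvgrPdist_lt _ _).1 cM _ e0.
exists (Num.min d (Num.min (t - a) (b - t))); first by rewrite /= !lt_min d0 !subr_gt0 at_.
move=> s; rewrite /= !lt_min => /and3P[/Hd].
rewrite !ltr_norml => /andP[h1 h2] /andP[h3 h4] /andP[h5 h6].
have [ts|ts] := leP t s.
  by apply: (le_lt_trans (gM _ _ (ltW at_) ts _)); lra.
by rewrite mdistC; apply: (le_lt_trans (gM _ _ _ (ltW ts) (ltW tb))); lra.
Qed.

Lemma EVI_flow_eps lambda E gamma k x (u : R) (t e : R) :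
  EVI_flow lambda E gamma -> 0 <= k -> - lambda <= k -> E x = u%:E -> 0 < t -> 0 < e ->
  \forall s \near t^'+, half_sqdist (gamma s) x <= half_sqdist (gamma t) x +
    (u - fine (E (gamma t)) + k * half_sqdist (gamma t) x + e) * (s - t).
Proof.
move=> [_ _ Efin evi] k0 lk Ex t0 e0.
have xE : eff_domain E x by rewrite /eff_domain /= Ex ltry.
have := evi x t xE t0; rewrite Ex -(fineK (Efin t t0)).
set phi := fine _; set w := mdist (gamma t) x ^+ 2; set U := upper_right_derivative _ _.
move=> HU.
have : (U < (2 * (u - phi - lambda / 2 * w + e))%:E)%E.
  move: HU; case: U => [U| |] //=; last by rewrite ltNyr.
    by rewrite -EFinM -EFinD -EFinB lee_fin lte_fin; lra.
  by rewrite gt0_muley ?lte_fin ?invr_gt0 // addye.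
move=> /ereal_inf_lt[_ [V [r /= r0 HV] <-] VU].
exists r => //= s rs ts.
have st0 : 0 < s - t by rewrite subr_gt0.
have Vs : V (s - t) by apply: HV => //=; rewrite sub0r normrN distrC.
have : (((mdist (gamma (t + (s - t))) x ^+ 2 - mdist (gamma (t + 0)) x ^+ 2) / (s - t))%:E <
   (2 * (u - phi - lambda / 2 * w + e))%:E)%E.
  apply: le_lt_trans VU; apply: ereal_sup_ubound; exists (s - t) => //.
  by rewrite addr0.
rewrite lte_fin ltr_pdivrMr // addr0 (_ : t + (s - t) = s); last by ring.
rewrite -/w => H.
have w0 : 0 <= w by exact: sqr_ge0.
have : - lambda * w * (s - t) <= k * w * (s - t).
  by rewrite ler_pM2r // ler_wpM2r.
by rewrite /half_sqdist -/w; lra.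
Qed.

Lemma EVI_flow_lsc lambda E gamma (t e : R) : EVI_flow lambda E gamma ->
  0 < t -> 0 < e ->
  \forall s \near t, fine (E (gamma t)) - e < fine (E (gamma s)).
Proof.
move=> [_ lsc Efin _] t0 e0.
have tin : `]0, +oo[%classic t by rewrite /= in_itv /= t0.
have [|V nV HV] := lsc t (fine (E (gamma t)) - e).
  by rewrite /= -[ltRHS](fineK (Efin t t0)) lte_fin; lra.
have [d /= d0 Hd] : within `]0, +oo[ (nbhs t) V by rewrite (nbhs_subspace_in tin).
exists (Num.min d t); first by rewrite /= lt_min d0.
move=> s; rewrite /= lt_min => /andP[sd st].
have s0 : 0 < s by move: st; rewrite ltr_norml => /andP[_]; lra.
have /HV : V s by apply: Hd; rewrite //= in_itv /= s0.
by rewrite -[ltRHS](fineK (Efin s s0)) lte_fin.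
Qed.

End EVI_flow_theory.

(** * Slopes *)

Section slopes.
Context {R : realType} {X : metricType R}.
Implicit Types (A B : set X) (d : X -> X -> \bar R) (E : X -> \bar R).
Local Open Scope ring_scope.
Local Open Scope ereal_scope.

(** Keeps the denominators of the slope at [y] away from [0] and [+oo]. *)
Definition positive_from A d (y : X) := forall x, A x -> x <> y ->
  exists2 r : R, (0 < r)%R & d y x = r%:E.

Lemma limf_esup_punctured_ge0 A d E y : positive_from A d y -> ~ isolated_in A d y ->
  0 <= limf_esup (fun x => maxe (E y - E x) 0 / d y x) (punctured_nbhs A d y).
Proof.
move=> dpos niso; apply: le_ereal_inf_tmp => _ [V [e e0 HV] <-].
have [x [Ax xe xy]] : exists x, [/\ A x, d y x < e%:E & x <> y].
  apply: contrapT => H; apply: niso; exists e => // x Ax xe.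
  by apply: contrapT => xy; apply: H; exists x.
have [r r0 dr] := dpos x Ax xy.
apply: le_ereal_sup_tmp; exists (maxe (E y - E x) 0 / d y x).
  by exists x => //; exact: HV.
by rewrite mule_ge0 ?inve_ge0 ?le_max ?lexx ?orbT // dr lee_fin ltW.
Qed.

Lemma slope_ge0 A d E y : positive_from A d y -> 0 <= slope A d E y.
Proof.
rewrite /slope; case: ifPn => // _ dpos; case: asboolP => // niso.
exact: limf_esup_punctured_ge0.
Qed.

(** Passing from [B] to [A] leaves fewer competitors, and a larger denominator lowers each
    nonnegative quotient. Isolation is inherited in the same direction, so the conventional value 0
    is consistent. *)
Lemma slope_le_slope A B dA dB E y : A `<=` B -> positive_from B dB y ->
  (forall x, A x -> x <> y -> dB y x <= dA y x < +oo) ->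
  slope A dA E y <= slope B dB E y.
Proof.
move=> AB dBpos dBA; rewrite /slope; case: ifPn => // _.
case: asboolP => [_|nisoA]; case: asboolP => [isoB|nisoB] //.
- exact: limf_esup_punctured_ge0.
- exfalso; apply: nisoA; have [e e0 He] := isoB; exists e => // x Ax xe.
  apply: contrapT => xy; apply: (xy); apply: He; first exact: AB.
  by have /andP[/le_lt_trans + _] := dBA _ Ax xy; apply.
- apply: le_ereal_inf_tmp => _ [V [e e0 HV] <-].
  apply: ge_ereal_inf.
  exists (ereal_sup [set maxe (E y - E x) 0 / dA y x
     | x in [set x | [/\ A x, x <> y & dA y x < e%:E]]]).
    by exists [set x | [/\ A x, x <> y & dA y x < e%:E]] => //; exists e.
  apply: ge_ereal_sup => _ [x [Ax xy xe] <-].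
  have /andP[dle dlt] := dBA x Ax xy.
  have [s s0 ds] := dBpos x (AB _ Ax) xy.
  apply: le_ereal_sup_tmp; exists (maxe (E y - E x) 0 / dB y x).
    by exists x => //; apply: HV => //; [exact: AB | exact: le_lt_trans xe].
  move: dle dlt; rewrite ds; case: (dA y x) => [r| |] //; rewrite lee_fin => sr _.
  have r0 : (0 < r)%R by exact: lt_le_trans sr.
  rewrite lee_wpmul2l ?le_max ?lexx ?orbT // !inver !gt_eqF //.
  by rewrite lee_fin lef_pV2.
Qed.

Lemma descent_of_slope_lt A d E y (v K : R) : positive_from A d y -> d y y = 0 ->
  E y = v%:E -> slope A d E y < K%:E ->
  exists2 e : R, (0 < e)%R & forall x (u : R), A x -> E x = u%:E ->
    (fine (d y x) < e -> v - u <= K * fine (d y x))%R.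
Proof.
move=> dpos dyy Ey; rewrite /slope Ey /=.
have yy x (u : R) : E x = u%:E -> x = y -> (v - u <= K * fine (d y x))%R.
  by move=> Ex xy; move: Ex; rewrite xy Ey dyy => -[->]; rewrite subrr mulr0.
case: asboolP => [[e e0 He] _|_].
  exists e => // x u Ax Ex xe; have [xy|xy] := pselect (x = y); first exact: yy.
  apply: (yy _ _ Ex); apply: He => //.
  have [r r0 dr] := dpos x Ax xy.
  by move: xe; rewrite dr lte_fin.
move=> /ereal_inf_lt[_ [V [e e0 HV] <-] VK].
exists e => // x u Ax Ex xe; have [xy|xy] := pselect (x = y); first exact: yy.
have [r r0 dr] := dpos x Ax xy.
move: xe; rewrite dr /= => re.
have Vx : V x by apply: HV => //; rewrite dr lte_fin.
have : maxe (v%:E - E x) 0 / d y x < K%:E.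
  by apply: le_lt_trans VK; apply: ereal_sup_ubound; exists x.
rewrite Ex dr -EFinB inver gt_eqF // -EFin_max -EFinM lte_fin.
rewrite ltr_pdivrMr // => /ltW; apply: le_trans.
by rewrite le_max lexx.
Qed.

Lemma slope_le_of_descent E y (v K k : R) : E y = v%:E -> (0 <= K)%R -> (0 <= k)%R ->
  (forall x, -oo < E x) ->
  (forall x (u : R), E x = u%:E ->
     (v - u <= K * mdist y x + k * half_sqdist y x)%R) ->
  slope [set: X] emdist E y <= K%:E.
Proof.
move=> Ey K0 k0 ENy H; rewrite /slope Ey /=.
case: asboolP => [_|_]; first by rewrite lee_fin.
apply/lee_addgt0Pr => e e0.
apply: ge_ereal_inf.
(* Within this radius the quadratic term is at most [e * mdist y x]. *)
pose r : R := (e / (k + 1))%R.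
have r0 : (0 < r)%R by rewrite divr_gt0 // ltr_wpDl.
exists (ereal_sup [set maxe (v%:E - E x) 0 / emdist y x
   | x in [set x | x <> y /\ emdist y x < r%:E]]).
  by exists [set x | x <> y /\ emdist y x < r%:E] => //; exists r.
apply: ge_ereal_sup => _ [x [xy xr] <-].
have d0 : (0 < mdist y x)%R by rewrite mdist_gt0; apply/eqP => yx; exact/xy/esym.
move: xr; rewrite /emdist lte_fin => xr.
rewrite inver gt_eqF //.
have := ENy x; case Ex : (E x) => [u| |] // _; last first.
  by rewrite max_r ?leNye // mul0e -EFinD lee_fin addr_ge0 // ltW.
rewrite -EFinB -EFin_max -EFinM -EFinD lee_fin ler_pdivrMr // ge_max.
have B0 : (0 <= (K + e) * mdist y x)%R by apply: mulr_ge0; [apply: addr_ge0 => // | ]; exact: ltW.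
rewrite B0 andbT; apply: (le_trans (H _ _ Ex)).
rewrite mulrDl lerD2l /half_sqdist.
have kr : ((k + 1) * mdist y x < e)%R.
  by rewrite mulrC -ltr_pdivlMr // ltr_wpDl.
have h : ((k + 1) * mdist y x * mdist y x <= e * mdist y x)%R.
  by rewrite ler_pM2r // ltW.
have kd : (0 <= k * mdist y x * mdist y x)%R by rewrite !mulr_ge0 // ltW.
have dd : (0 <= mdist y x * mdist y x)%R by rewrite mulr_ge0 // ltW.
by move: kd h dd; clear; rewrite expr2; lra.
Qed.

End slopes.

(** * Equality of the three slopes *)

Theorem proposition2p5 (R : realType) (lambda : R) (X : metricType R)
    (E : X -> \bar R) (Y : set X)
    (E_gtNy : forall x, -oo < E x)
    (E_bounded_below : exists c : R, forall x, c%:E <= E x)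
    (E_proper : eff_domain E !=set0)
    (Y_metric : metric_on Y (length_dist Y))
    (Y_flow : forall y, Y y -> eff_domain E y ->
      exists gamma : R -> X,
        [/\ EVI_flow lambda E gamma,
            starts_from E gamma y &
            forall t : R, (0 < t)%R -> Y (gamma t)]) :
  forall y, Y y ->
    slope [set: X] emdist E y = slope Y (length_dist Y) E y /\
    slope Y (length_dist Y) E y = slope Y emdist E y.
Proof.
move=> y Yy.
have [Y_fin Y_eq0 _ _] := Y_metric.
have dYfin x x' : Y x -> Y x' -> length_dist Y x x' \is a fin_num.
  by move=> Yx Yx'; have /andP[h0 h1] := Y_fin _ _ Yx Yx'; rewrite ge0_fin_numE.
have dXY x x' : Y x -> Y x' -> emdist x x' <= length_dist Y x x'.
  move=> Yx Yx'; apply: le_ereal_inf_tmp => _ [c [cAC _ <- <-] <-].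
  exact: mdist_le_integral_metric_derivative.
have Xpos A x : A x -> x <> y -> exists2 r : R, (0 < r)%R & emdist y x = r%:E.
  move=> _ xy; exists (mdist y x) => //.
  by rewrite mdist_gt0; apply/eqP => yx; exact/xy/esym.
have Ypos x : Y x -> x <> y -> exists2 r : R, (0 < r)%R & length_dist Y y x = r%:E.
  move=> Yx xy; exists (fine (length_dist Y y x)); last by rewrite fineK // dYfin.
  have /andP[h0 _] := Y_fin _ _ Yy Yx.
  rewrite fine_gt0 // lt_neqAle h0 andbT ltey_eq dYfin // andbT.
  by apply/eqP => /esym /(Y_eq0 _ _ Yy Yx) yx; exact/xy/esym.
have YX : slope Y emdist E y <= slope [set: X] emdist E y.
  apply: slope_le_slope => //; first exact: (Xpos setT).
  by move=> x _ _; rewrite lexx ltry.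
have YY : slope Y (length_dist Y) E y <= slope Y emdist E y.
  apply: slope_le_slope => //; first exact: (Xpos Y).
  move=> x Yx _; rewrite dXY //=.
  by have /andP[] := Y_fin _ _ Yy Yx.
suff XY : slope [set: X] emdist E y <= slope Y (length_dist Y) E y.
  split; apply/eqP; rewrite eq_le.
    by rewrite XY (le_trans YY YX).
  by rewrite YY (le_trans YX XY).
(* At infinite energy all slopes are [+oo] by convention. *)
have := E_gtNy y; case Ey : (E y) => [v| |] // _; last by rewrite /slope Ey.
have S0 := @slope_ge0 _ _ Y (length_dist Y) E y Ypos.
case SE : (slope Y (length_dist Y) E y) => [s| |]; last 2 first.
  by rewrite leey.
  by rewrite SE in S0.
(* The slack [e] makes [K = s + e] positive and strictly larger than the slope, so that energy
   descent holds near [y] in the length distance. *)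
apply/lee_addgt0Pr => e e0; rewrite -EFinD.
have s0 : (0 <= s)%R by rewrite SE in S0.
have K0 : (0 < s + e)%R by rewrite ltr_wpDl.
have [||r r0 Hr] := @descent_of_slope_lt _ _ Y (length_dist Y) E y v (s + e)%R Ypos _ Ey.
- exact/Y_eq0.
- by rewrite SE lte_fin ltrDl.
have [gamma [gEVI [g0 _] Yg]] : exists gamma : R -> X,
    [/\ EVI_flow lambda E gamma, starts_from E gamma y &
      forall t : R, (0 < t)%R -> Y (gamma t)].
  by apply: Y_flow => //; rewrite /eff_domain /= Ey ltry.
have [gAC _ Efin _] := gEVI.
pose k : R := Num.max (- lambda)%R 0%R.
have k0 : (0 <= k)%R by rewrite le_max lexx orbT.
have lk : (- lambda <= k)%R by rewrite le_max lexx.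
have gC (t : R) (t0 : (0 < t)%R) := AC2loc_continuous gAC t0.
have gL (t : R) (t0 : (0 < t)%R) (f : R) (f0 : (0 < f)%R) := EVI_flow_lsc gEVI t0 f0.
have gE (t : R) : (0 < t)%R -> E (gamma t) = (fine (E (gamma t)))%:E.
  by move=> t0; rewrite fineK // Efin.
have gV x (u : R) (Ex : E x = u%:E) (t : R) (t0 : (0 < t)%R) (f : R) (f0 : (0 < f)%R) :=
  EVI_flow_eps gEVI k0 lk Ex t0 f0.
have [c Ec] := E_bounded_below.
have phi_bounds (t : R) : (0 < t)%R -> (c <= fine (E (gamma t)) <= v)%R.
  move=> t0; rewrite -lee_fin -gE // Ec /=.
  exact: (phi_le_start k0 gC gL gE gV Ey g0 t0).
apply: (slope_le_of_descent Ey (ltW K0) k0) => // x u Ex.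
apply: (descent_of_length_descent k0 gC gL gE gV Y_metric Yy Yg g0 phi_bounds K0 r0 _ _ Ex).
- by move=> x1 x2 Yx1 Yx2; rewrite -lee_fin fineK ?dYfin // dXY.
- by move=> x' u' Yx' Ex'; exact: Hr.
Qed.
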